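(* Let $Z=\{r_ne^{it_n}\}$ be a sequence in $\mathbb{D}\setminus\{0\}$ (with $r_n\in(0,1)$, $t_n\in\mathbb{R}$) that is a zero sequence for the Dirichlet space $\mathcal{D}$, and for each $n$ let $0<r_n\le s_n<1$. Then $W=\{s_ne^{it_n}\}$ is a zero sequence for $\mathcal{D}$ and $\gamma_{\mathcal{D}}(W)\ge\gamma_{\mathcal{D}}(Z)$.
   Context: $\mathbb{D}$ is the open unit disc in $\mathbb{C}$. The Dirichlet space $\mathcal{D}$ is the space of analytic functions $f$ on $\mathbb{D}$ with $\int_{\mathbb{D}}|f'|^2\,dA<\infty$ ($A$ normalized area measure), with the norm $\|f\|^2=\int_{\mathbb{D}}|f'|^2\,dA+\|f\|_{H^2}^2=\sum_{n\ge0}(n+1)|\widehat f(n)|^2$, where $f(z)=\sum_n\widehat f(n)z^n$ and $H^2$ is the Hardy space on $\mathbb{D}$. Sequences may contain each point finitely many times; repetitions encode multiplicities. A holomorphic function $f$ vanishes on a sequence $S$ if it has a zero of multiplicity $\ge k$ at each $z$ repeated $k$ times in $S$; it vanishes exactly on $S$ if the multiplicity is exactly $k$ at each such $z$ and $f\ne0$ on $\mathbb{D}\setminus S$. $S$ is a zero sequence (zero set) for $\mathcal{D}$ if there is $f\in\mathcal{D}$ vanishing exactly on $S$. For a sequence $S$ in $\mathbb{D}$, $\gamma_{\mathcal{D}}(S)=\sup\{\operatorname{Re}f(0):f\in\mathcal{D},\ f\text{ vanishes on }S,\ \|f\|\le1\}$. *)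

(* Defs.v *)
From HB Require Import structures.
From mathcomp Require Import all_boot all_order all_algebra.
From mathcomp Require Import all_classical all_reals all_analysis.
From mathcomp Require Import complex.

Set Implicit Arguments.
Unset Strict Implicit.
Unset Printing Implicit Defensive.

Import Order.TTheory GRing.Theory Num.Theory.
Import numFieldNormedType.Exports.

Local Open Scope classical_set_scope.
Local Open Scope ring_scope.
Local Open Scope complex_scope.

Section Dirichlet.
Variable R : realType.
Local Notation C := (R[i] : numClosedFieldType).
Implicit Types (f : C -> C) (z : C) (J : set nat) (S : nat -> C).

Definition disc : set C := [set z | `|z| < 1].

(* Functions are total on C; only their values on [disc] matter. *)
Definition analytic f : Prop :=
  exists a : nat -> C, forall z, disc z ->
    (fun n => \sum_(0 <= k < n) a k * z ^+ k) @ \oo --> f z.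

(* Here and below derivatives are complex: they are limits over h in R[i]. *)
Definition taylor_coef f (n : nat) : C := derive1n n f 0 / (n`!)%:R.

Definition sqrnorm z : R := complex.Re z ^+ 2 + complex.Im z ^+ 2.

Definition area := ((@lebesgue_measure R) \x (@lebesgue_measure R))%E.

Definition disc2 : set (measurableTypeR R * measurableTypeR R) :=
  [set p | disc (p.1 +i* p.2)].

(* Dividing by the area of the disc makes the area measure normalized. *)
Definition dirichlet_integral f : \bar R :=
  ((fine (area disc2))^-1%:E *
    \int[area]_(p in disc2) (sqrnorm (derive1 f (p.1 +i* p.2)))%:E)%E.

Definition hardy_sqnorm f : \bar R :=
  (\sum_(0 <= n <oo) (sqrnorm (taylor_coef f n))%:E)%E.

Definition dirichlet_space f : Prop :=
  analytic f /\ (dirichlet_integral f < +oo)%E.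

Definition dirichlet_norm f : \bar R :=
  sqrte (dirichlet_integral f + hardy_sqnorm f)%E.

Definition zero_order_ge f z (k : nat) : Prop :=
  exists2 g, analytic g & forall w, disc w -> f w = (w - z) ^+ k * g w.

(* Order 0 means f z <> 0. *)
Definition zero_order_eq f z (k : nat) : Prop :=
  exists2 g, analytic g /\ g z <> 0 &
    forall w, disc w -> f w = (w - z) ^+ k * g w.

(* A (finite or infinite) sequence is the restriction of [S] to the index set
   [J]; [occurrences J S z] has as many elements as z has repetitions. *)
Definition occurrences J S z : set nat := [set n | J n /\ S n = z].

Definition disc_sequence J S : Prop :=
  (forall n, J n -> disc (S n)) /\ (forall z, finite_set (occurrences J S z)).

Definition vanishes_on J S f : Prop :=
  forall z k, disc z -> (occurrences J S z #= `I_k)%card -> zero_order_ge f z k.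

(* At the points z outside the sequence this is the case k = 0, which says
   that f z <> 0. *)
Definition vanishes_exactly_on J S f : Prop :=
  forall z k, disc z -> (occurrences J S z #= `I_k)%card -> zero_order_eq f z k.

Definition zero_sequence J S : Prop :=
  disc_sequence J S /\
  exists2 f, dirichlet_space f & vanishes_exactly_on J S f.

Definition gamma J S : \bar R :=
  ereal_sup [set (complex.Re (f 0))%:E | f in
    [set f | [/\ dirichlet_space f, vanishes_on J S f &
                 (dirichlet_norm f <= 1)%E]]].

Definition polar (r t : R) : C := (r * cos t) +i* (r * sin t).

End Dirichlet.

(* Main.v *)
(** Let c = 1/z_n and d = 1/w_n for a zero z_n that is pushed radially out to
w_n.  If f = (1 - c z) h then (1 - d z) h has the same value at 0, and its
Dirichlet norm is not larger: along the ray, the derivative of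
|h - x z h|^2 = |h|^2 - 2 x Re<h, z h> + x^2 |z h|^2 in x >= 1 is nonnegative
because |z h| >= |h|.  Pushing the zeros one after another gives functions
f_n of norm at most |f| with f_n(0) = f(0).  For the given zero sequence,
reflecting the zeros in the circle multiplies the H^2 norm by |z_n| and keeps
the value at 0, which yields the Blaschke condition; hence the Taylor
coefficients of f_n converge, and so do those of f_n divided by finitely many
of its zeros.  Near a point of the disc the remaining factors
(1 - d z) / (1 - c z) have a product bounded away from 0, so the limit has
exactly the new zeros.

The norm is computed by Parseval on the disc: multiplication by w scales area
by |w|^2, so rotations make distinct monomials orthogonal and dilations
determine the integral of |z|^2n over the disc. *)

Require Import Defs.
From mathcomp Require Import all_boot all_order all_algebra.
From mathcomp Require Import all_classical all_reals all_analysis.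
From mathcomp Require Import measurable_realfun.
From mathcomp Require Import complex ring lra zify.

Set Implicit Arguments.
Unset Strict Implicit.
Unset Printing Implicit Defensive.

Import Order.TTheory GRing.Theory Num.Theory.
Import numFieldNormedType.Exports.

Local Open Scope classical_set_scope.
Local Open Scope ring_scope.

(** * Modulus and power series *)

(** All estimates are made on coefficient sequences, where division by 1 - c z is always possible
    ([ldiv]); analyticity and size become the separate bounds [subexp] and [wle]. The obstacle is
    that h = f / (1 - c z) is not known to have finite norm when the norms are compared: truncated
    sums leave a boundary term, and subexponential growth supplies truncations at which it is
    harmless. Reflection in the circle leaves another boundary term, which tends to 0 once h is
    known to have finite norm. The Blaschke sum controls the moves because c and d lie on one ray
    outside the unit disc, so |c - d| = |c| - |d| < |c| - 1. The norm bounds obtained for the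
    quotients depend on the number of steps, so convergence is proved coefficient by coefficient. A
    function vanishing exactly on the sequence yields the Blaschke condition; the limit argument
    then applies to every function vanishing at least there, as the supremum [gamma] requires. *)

Section ComplexModulus.
Variable R : realType.
Local Notation C := (R[i] : numClosedFieldType).
Implicit Types x y z : C.

(* [normr] takes its values in [R[i]]; [nc] is the same modulus as a real. *)
Definition nc (z : C) : R := Num.sqrt (sqrnorm z).

Lemma sqrnorm_ge0 z : 0 <= sqrnorm z.
Proof. by rewrite addr_ge0 ?sqr_ge0. Qed.

Lemma nc_ge0 z : 0 <= nc z. Proof. exact: sqrtr_ge0. Qed.
Hint Resolve nc_ge0 : core.

Lemma sqr_nc z : nc z ^+ 2 = sqrnorm z.
Proof. by rewrite sqr_sqrtr// sqrnorm_ge0. Qed.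

Lemma normcE z : `|z| = (nc z)%:C%C.
Proof. exact: normc_def. Qed.

Lemma discE z : disc z <-> nc z < 1.
Proof. by rewrite /disc /= normcE -ltcR. Qed.

Lemma nc_inj x : (nc x)%:C%C = `|x|. Proof. by rewrite normcE. Qed.

Lemma ncM x y : nc (x * y) = nc x * nc y.
Proof. by apply: (@complexI R); rewrite rmorphM /= !nc_inj normrM. Qed.

Lemma nc0 : nc 0 = 0.
Proof. by apply: (@complexI R); rewrite nc_inj normr0. Qed.

Lemma nc1 : nc 1 = 1.
Proof. by apply: (@complexI R); rewrite nc_inj normr1. Qed.

Lemma ncN x : nc (- x) = nc x.
Proof. by apply: (@complexI R); rewrite !nc_inj normrN. Qed.

Lemma nc_distC x y : nc (x - y) = nc (y - x).
Proof. by rewrite -ncN opprB. Qed.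

Lemma ncV x : nc x^-1 = (nc x)^-1.
Proof. by apply: (@complexI R); rewrite fmorphV /= !nc_inj normfV. Qed.

Lemma ncX x n : nc (x ^+ n) = nc x ^+ n.
Proof. by apply: (@complexI R); rewrite rmorphXn /= !nc_inj normrX. Qed.

Lemma nc_nat n : nc n%:R = n%:R.
Proof. by apply: (@complexI R); rewrite rmorph_nat nc_inj normr_nat. Qed.

Lemma nc_real (r : R) : nc r%:C%C = `|r|.
Proof. by rewrite /nc /sqrnorm /= expr0n addr0 sqrtr_sqr. Qed.

Lemma nc_eq0 x : (nc x == 0) = (x == 0).
Proof. by rewrite -(inj_eq (@complexI R)) nc_inj normr_eq0. Qed.

Lemma nc_gt0 x : (0 < nc x) = (x != 0).
Proof. by rewrite lt_neqAle nc_ge0 andbT eq_sym nc_eq0. Qed.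

Lemma ler_ncD x y : nc (x + y) <= nc x + nc y.
Proof. by rewrite -lecR rmorphD /= !nc_inj ler_normD. Qed.

Lemma ler_ncB x y : nc (x - y) <= nc x + nc y.
Proof. by rewrite -(ncN y) ler_ncD. Qed.

Lemma ler_nc_sub x y : nc x - nc y <= nc (x - y).
Proof. by rewrite lerBlDr -{1}(subrK y x) ler_ncD. Qed.

Lemma ler_nc_sum I (r : seq I) (P : pred I) (F : I -> C) :
  nc (\sum_(i <- r | P i) F i) <= \sum_(i <- r | P i) nc (F i).
Proof.
elim/big_ind2 : _ => //; first by rewrite nc0.
by move=> x1 x2 y1 y2 h1 h2; rewrite (le_trans (ler_ncD _ _))// lerD.
Qed.

Lemma normRe_le z : `|complex.Re z| <= nc z.
Proof. by rewrite -[leLHS]sqrtr_sqr ler_sqrt ?sqrnorm_ge0// lerDl sqr_ge0. Qed.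

Lemma normIm_le z : `|complex.Im z| <= nc z.
Proof. by rewrite -[leLHS]sqrtr_sqr ler_sqrt ?sqrnorm_ge0// lerDr sqr_ge0. Qed.

Lemma nc_le_ReIm z : nc z <= `|complex.Re z| + `|complex.Im z|.
Proof.
rewrite {1}[z]complexE.
rewrite (le_trans (ler_ncD _ _))// ncM !nc_real /=.
have -> : nc 'i%C = 1 by rewrite /nc /sqrnorm /= expr0n add0r expr1n sqrtr1.
by rewrite mul1r.
Qed.

Lemma sqrnormM x y : sqrnorm (x * y) = sqrnorm x * sqrnorm y.
Proof. by rewrite -!sqr_nc ncM exprMn. Qed.

(** The radii in [cvgrPdist_lt] range over [C], but a positive element of [C] is real, so real radii
    suffice. *)
Lemma ccvgP (u : nat -> C) (l : C) :
  (u @ \oo --> l) <-> (nc (u n - l) @[n --> \oo] --> (0 : R)).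
Proof.
split=> [/cvgrPdist_lt ul|/cvgrPdist_lt ul].
  apply/cvgrPdist_lt => e e0; have e0' : 0 < e%:C%C :> C by rewrite ltcR.
  have := ul _ e0'; apply: filterS => n.
  by rewrite sub0r normrN normcE ltcR nc_distC (ger0_norm (nc_ge0 _)).
apply/cvgrPdist_lt => e e0.
have eE : e = (complex.Re e)%:C%C by rewrite RRe_real// gtr0_real.
move: e0; rewrite eE ltcR => e0; have := ul _ e0; apply: filterS => n.
by rewrite sub0r normrN normcE ltcR nc_distC (ger0_norm (nc_ge0 _)).
Qed.

End ComplexModulus.
#[global] Hint Extern 0 (is_true (0 <= nc _)) => solve [apply: nc_ge0] : core.

(** * Power series on the disc: convergence, termwise differentiation, uniqueness of coefficients *)

Section PowerSeries.
Variable R : realType.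
Local Notation C := (R[i] : numClosedFieldType).
Implicit Types (x y z w : C) (a b : nat -> C) (f g : C -> C).

Definition has_series a f := forall z, disc z ->
  (fun n => \sum_(0 <= k < n) a k * z ^+ k) @ \oo --> f z.

(* Equivalent to convergence of the power series on the whole disc. *)
Definition subexp a := forall rho : R, 0 <= rho < 1 ->
  exists M, forall k, nc (a k) * rho ^+ k <= M.

Lemma cvg_nc_le (u : nat -> C) l (K : R) : u @ \oo --> l ->
  (forall n, nc (u n) <= K) -> nc l <= K.
Proof.
move=> /ccvgP /cvgrPdist_lt ul uK; apply/ler_addgt0Pr => e e0.
have [N _ /(_ N (leqnn N))] := ul _ e0.
rewrite /= sub0r normrN (ger0_norm (nc_ge0 _)) => h.
rewrite -[l](subrK (u N)) (le_trans (ler_ncD _ _))// addrC lerD//.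
by rewrite nc_distC ltW.
Qed.

Lemma ccvg_unique (u : nat -> C) (l l' : C) : u @ \oo --> l -> u @ \oo --> l' -> l = l'.
Proof.
move=> h h'; apply/eqP; rewrite -subr_eq0 -nc_eq0 eq_le nc_ge0 andbT.
by apply: (cvg_nc_le (cvgB h h')) => n /=; rewrite subrr nc0.
Qed.

Lemma cvg0_bounded (v : nat -> R) : (v n @[n --> \oo] --> 0) ->
  exists M, forall n, v n <= M.
Proof.
move=> v0; have /cvg_seq_bounded : cvgn v by apply/cvg_ex; exists 0.
move=> /pinfty_ex_gt0[M M0 h]; exists M => n.
by rewrite (le_trans (ler_norm _))// h.
Qed.

(** At the real point [rho] the partial sums stay within M of their limit, and each term is a
    difference of two of them. *)
Lemma has_series_subexp a f : has_series a f -> subexp a.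
Proof.
move=> af rho /andP[rho0 rho1]; set z : C := (rho%:C)%C.
have zd : disc z by apply/discE; rewrite nc_real ger0_norm.
have /ccvgP/cvg0_bounded[M hM] := af z zd.
exists (M + M) => k.
have -> : rho ^+ k = nc (z ^+ k) by rewrite ncX nc_real ger0_norm.
rewrite -ncM.
have -> : a k * z ^+ k = (\sum_(0 <= j < k.+1) a j * z ^+ j - f z)
   - (\sum_(0 <= j < k) a j * z ^+ j - f z).
  by rewrite big_nat_recr //=; ring.
by rewrite (le_trans (ler_ncB _ _))// lerD//; exact: hM.
Qed.

Lemma geo_sum_le (q : R) n : 0 <= q < 1 -> \sum_(0 <= k < n) q ^+ k <= (1 - q)^-1.
Proof.
move=> /andP[q0 q1]; rewrite -[leRHS]mul1r ler_pdivlMr ?subr_gt0//.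
rewrite big_mkord -opprB mulrN mulrC -subrX1 opprB lerBlDr lerDl.
exact: exprn_ge0.
Qed.

Lemma subexp_sum a rho : subexp a -> 0 <= rho < 1 ->
  exists M : R, forall n, \sum_(0 <= k < n) nc (a k) * rho ^+ k <= M.
Proof.
move=> ra /andP[r0 r1].
have [M hM] := ra ((1 + rho) / 2) ltac:(lra).
(* Boundedness at the larger radius r' makes the terms at [rho] geometric of ratio q. *)
set r' := (1 + rho) / 2 in hM; set q := rho / r'.
have r'0 : 0 < r' by rewrite /r'; lra.
have q01 : 0 <= q < 1.
  by rewrite divr_ge0 ?(ltW r'0)//= ltr_pdivrMr// mul1r /r'; lra.
have M0 : 0 <= M by apply: le_trans (hM 0%N); rewrite mulr_ge0 ?expr0.
exists (M * (1 - q)^-1) => n.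
apply: (@le_trans _ _ (\sum_(0 <= k < n) M * q ^+ k)).
  apply: ler_sum => k _.
  rewrite -[rho in leLHS](divfK (lt0r_neq0 r'0)) -/q exprMn mulrCA mulrC.
  by apply: ler_wpM2r => //; rewrite exprn_ge0//; case/andP: q01.
by rewrite -mulr_sumr ler_wpM2l// geo_sum_le.
Qed.

Lemma cvg_abs_series (u : nat -> R) (M : R) :
  (forall n, \sum_(0 <= k < n) `|u k| <= M) ->
  cvgn (fun n => \sum_(0 <= k < n) u k).
Proof.
move=> h; apply: (@normed_cvg R R^o u).
apply: nondecreasing_is_cvgn.
  by apply: nondecreasing_series => n _ _; rewrite /=.
by exists M => _ [n _ <-]; exact: h.
Qed.

Lemma Re_sum I (r : seq I) (P : pred I) (F : I -> C) :
  complex.Re (\sum_(i <- r | P i) F i) = \sum_(i <- r | P i) complex.Re (F i).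
Proof. exact: raddf_sum. Qed.

Lemma Im_sum I (r : seq I) (P : pred I) (F : I -> C) :
  complex.Im (\sum_(i <- r | P i) F i) = \sum_(i <- r | P i) complex.Im (F i).
Proof. exact: raddf_sum. Qed.

Lemma cvg_ReIm (u : nat -> C) :
  cvgn (fun n => complex.Re (u n)) -> cvgn (fun n => complex.Im (u n)) ->
  exists l : C, u @ \oo --> l.
Proof.
move=> /cvg_ex[p up] /cvg_ex[q uq]; exists ((p +i* q)%C : C); apply/ccvgP.
have h : `|complex.Re (u n) - p| + `|complex.Im (u n) - q| @[n --> \oo] --> (0:R).
  rewrite -[X in _ --> X](addr0 0); apply: cvgD.
    by rewrite -(@normr0 _ R) -(subrr p); apply: cvg_norm; apply: cvgB up (cvg_cst _).
  by rewrite -(@normr0 _ R) -(subrr q); apply: cvg_norm; apply: cvgB uq (cvg_cst _).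
apply: (squeeze_cvgr _ (cvg_cst 0) h).
apply: nearW => n; rewrite nc_ge0 /= (le_trans (nc_le_ReIm _))//.
by rewrite !raddfB.
Qed.

Lemma cvg_abs_cseries (u : nat -> C) (M : R) :
  (forall n, \sum_(0 <= k < n) nc (u k) <= M) ->
  exists l : C, (fun n => \sum_(0 <= k < n) u k) @ \oo --> l.
Proof.
move=> h; apply: cvg_ReIm.
  under eq_fun do rewrite Re_sum; apply: (@cvg_abs_series _ M) => n.
  by apply: le_trans (h n); apply: ler_sum => k _; exact: normRe_le.
under eq_fun do rewrite Im_sum; apply: (@cvg_abs_series _ M) => n.
by apply: le_trans (h n); apply: ler_sum => k _; exact: normIm_le.
Qed.

Lemma subexp_has_series a : subexp a -> exists f, has_series a f.
Proof.
move=> ra.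
have h z : exists l : C, disc z ->
    (fun n => \sum_(0 <= k < n) a k * z ^+ k) @ \oo --> l.
  have [zd|zd] := pselect (disc z); last by exists 0.
  have z1 : 0 <= nc z < 1 by rewrite nc_ge0; apply/discE.
  have [M hM] := subexp_sum ra z1.
  have [l hl] : exists l : C, (fun n => \sum_(0 <= k < n) a k * z ^+ k) @ \oo --> l.
    apply: (@cvg_abs_cseries _ M) => n; apply: le_trans (hM n).
    by apply: ler_sum => k _; rewrite ncM ncX.
  by exists l.
by have [f hf] := choice h; exists f => z zd; exact: hf.
Qed.

Definition dser a : nat -> C := fun k => k.+1%:R * a k.+1.

(** The factor k + 1 is absorbed by a slightly larger radius: (k + 1) q^k is at most 1 + q + ... +
    q^k, hence at most 1 / (1 - q). *)
Lemma subexp_dser a : subexp a -> subexp (dser a).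
Proof.
move=> ra rho /andP[r0 r1].
have [M hM] := ra ((1 + rho) / 2) ltac:(lra).
set r' := (1 + rho) / 2 in hM; set q := rho / r'.
have r'0 : 0 < r' by rewrite /r'; lra.
have q01 : 0 <= q < 1.
  by rewrite divr_ge0 ?(ltW r'0)//= ltr_pdivrMr// mul1r /r'; lra.
have M0 : 0 <= M by apply: le_trans (hM 0%N); rewrite mulr_ge0 ?expr0.
exists ((1 - q)^-1 * (M / r')) => k.
rewrite /dser ncM nc_nat -[rho in leLHS](divfK (lt0r_neq0 r'0)) -/q exprMn.
have -> : k.+1%:R * nc (a k.+1) * (q ^+ k * r' ^+ k) =
  (k.+1%:R * q ^+ k) * (nc (a k.+1) * r' ^+ k) by ring.
have /andP[q0 q1] := q01.
apply: ler_pM; rewrite ?mulr_ge0 ?exprn_ge0 ?(ltW r'0)//.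
  apply: (le_trans _ (geo_sum_le k.+1 q01)).
  rewrite -[k.+1 in leLHS]subn0 mulr_natl -sumr_const_nat big_nat_cond [leRHS]big_nat_cond.
  apply: ler_sum => i /andP[/andP[_ ik] _].
  by apply: ler_wiXn2l => //; exact: ltW.
by rewrite ler_pdivlMr// -mulrA -exprSr hM.
Qed.

(** Second-order Taylor remainder of a monomial. The constant is twice the optimal one, so that it
    equals the factor of a_(n+2) in [dser (dser a)]. *)
Lemma nc_expB2 w z (rho : R) n : nc w <= rho -> nc z <= rho ->
  nc (w ^+ n.+2 - z ^+ n.+2 - n.+2%:R * z ^+ n.+1 * (w - z)) <=
  n.+1%:R * n.+2%:R * rho ^+ n * nc (w - z) ^+ 2.
Proof.
move=> wr zr; have r0 : 0 <= rho by exact: le_trans zr.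
elim: n => [|n IH].
  have -> : w ^+ 2 - z ^+ 2 - 2%:R * z ^+ 1 * (w - z) = (w - z) ^+ 2 by ring.
  by rewrite ncX expr0 mul1r mulr1 ler_peMl ?sqr_ge0// ler1n.
have -> : w ^+ n.+3 - z ^+ n.+3 - n.+3%:R * z ^+ n.+2 * (w - z) =
   w * (w ^+ n.+2 - z ^+ n.+2 - n.+2%:R * z ^+ n.+1 * (w - z)) +
   n.+2%:R * z ^+ n.+1 * (w - z) ^+ 2.
  by rewrite -[n.+3%:R]natr1 !exprS; ring.
rewrite (le_trans (ler_ncD _ _))// !ncM !ncX nc_nat.
apply: (@le_trans _ _ (rho * (n.+1%:R * n.+2%:R * rho ^+ n * nc (w - z) ^+ 2)
   + n.+2%:R * rho ^+ n.+1 * nc (w - z) ^+ 2)).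
  apply: lerD; first by apply: ler_pM.
  apply: ler_wpM2r; rewrite ?sqr_ge0//; apply: ler_wpM2l => //.
  by rewrite lerXn2r ?nnegrE.
have -> : rho * (n.+1%:R * n.+2%:R * rho ^+ n * nc (w - z) ^+ 2) +
  n.+2%:R * rho ^+ n.+1 * nc (w - z) ^+ 2 =
  (n.+2%:R * n.+2%:R) * (rho ^+ n.+1 * nc (w - z) ^+ 2).
  by rewrite (exprS rho) -[n.+2%:R]natr1; ring.
rewrite -[leRHS]mulrA; apply: ler_wpM2r; first by rewrite mulr_ge0 ?sqr_ge0 ?exprn_ge0.
by rewrite ler_wpM2l// ler_nat.
Qed.

Lemma has_series_taylor1 a f G z w (rho K : R) :
  has_series a f -> has_series (dser a) G -> nc w <= rho -> nc z <= rho -> rho < 1 ->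
  (forall n, \sum_(0 <= k < n) nc (dser (dser a) k) * rho ^+ k <= K) ->
  nc (f w - f z - G z * (w - z)) <= K * nc (w - z) ^+ 2.
Proof.
move=> af aG wr zr r1 hK.
have wd : disc w by apply/discE; lra.
have zd : disc z by apply/discE; lra.
pose S w n := \sum_(0 <= k < n) a k * w ^+ k.
pose T n := \sum_(0 <= k < n) dser a k * z ^+ k.
(* With these offsets all sums stop at the same degree, and the terms of degree 0 and 1 cancel. *)
apply: (@cvg_nc_le (fun n => S w n.+2 - S z n.+2 - T n.+1 * (w - z))).
  apply: cvgB; [apply: cvgB|apply: cvgMr_tmp].
  - by have := af w wd; rewrite -cvg_shiftS -cvg_shiftS.
  - by have := af z zd; rewrite -cvg_shiftS -cvg_shiftS.
  - by have := aG z zd; rewrite -cvg_shiftS.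
move=> n; apply: (@le_trans _ _ (\sum_(0 <= k < n) (nc (dser (dser a) k) * rho ^+ k * nc (w - z) ^+2))); last first.
  by rewrite -mulr_suml ler_wpM2r ?sqr_ge0.
have -> : S w n.+2 - S z n.+2 - T n.+1 * (w - z) =
  \sum_(0 <= k < n) a k.+2 * (w ^+ k.+2 - z ^+ k.+2 - k.+2%:R * z ^+ k.+1 * (w - z)).
  elim: n => [|n IH].
    rewrite /S /T !big_nat_recr //= !big_nil /dser; ring.
  rewrite big_nat_recr//= -IH /S /T.
  rewrite [\sum_(0 <= k < n.+3) _ * w ^+ _]big_nat_recr //=.
  rewrite [\sum_(0 <= k < n.+3) _ * z ^+ _]big_nat_recr //=.
  rewrite [\sum_(0 <= k < n.+2) dser _ _ * _]big_nat_recr //=.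
  rewrite /dser; ring.
rewrite (le_trans (ler_nc_sum _ _ _))//; apply: ler_sum => k _.
rewrite ncM /dser !ncM !nc_nat.
have -> : k.+1%:R * (k.+2%:R * nc (a k.+2)) * rho ^+ k * nc (w - z) ^+ 2 =
 nc (a k.+2) * (k.+1%:R * k.+2%:R * rho ^+ k * nc (w - z) ^+ 2) by ring.
by rewrite ler_wpM2l// nc_expB2.
Qed.

Lemma is_derive_series a f : has_series a f ->
  exists2 G, has_series (dser a) G & forall z, disc z -> derive1 f z = G z.
Proof.
move=> af; have ra := has_series_subexp af; have rda := subexp_dser ra.
have [G aG] := subexp_has_series rda; exists G => // z zd.
rewrite derive1E /derive; apply/cvg_lim => //.
have zd1 := zd; move/discE in zd1.
(* Increments shorter than (1 - |z|) / 2 keep z + h within this radius, where the quadratic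
   remainder bound holds. *)
pose rho := (1 + nc z) / 2.
have rho01 : 0 <= rho < 1 by have := nc_ge0 z; rewrite /rho; lra.
have [K hK] := subexp_sum (subexp_dser rda) rho01.
have K0 : 0 <= K by have := hK 0%N; rewrite big_nil.
have d0 : 0 < (1 - nc z) / 2 by lra.
have main (h : C) : nc h < (1 - nc z) / 2 -> h != 0 ->
    nc (h^-1 * (f (h + z) - f z) - G z) <= K * nc h.
  move=> hd h0.
  have hz : nc (h + z) <= rho by rewrite (le_trans (ler_ncD _ _))// /rho; lra.
  have zr : nc z <= rho by rewrite /rho; lra.
  have := has_series_taylor1 af aG hz zr (andP rho01).2 hK.
  rewrite addrK => H.
  have -> : h^-1 * (f (h + z) - f z) - G z = h^-1 * (f (h + z) - f z - G z * h).
    by rewrite [RHS]mulrBr [h^-1 * (G z * h)]mulrC mulfK.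
  rewrite ncM ncV mulrC ler_pdivrMr ?nc_gt0//.
  by rewrite -mulrA -expr2.
apply/cvgrPdist_le => e e0.
have eE : e = (complex.Re e)%:C%C by rewrite RRe_real// gtr0_real.
move: e0; rewrite eE ltcR; set e' := complex.Re e => e0.
(* K may be 0, hence the division by K + 1 below. *)
have K1 : 0 < K + 1 by lra.
have D0 : 0 < (Num.min ((1 - nc z) / 2) (e' / (K + 1)))%:C%C :> C.
  by rewrite ltcR lt_min d0 divr_gt0.
near=> h.
have h0 : h != 0 by near: h; exact: nbhs_dnbhs_neq.
have : `|h| < (Num.min ((1 - nc z) / 2) (e' / (K + 1)))%:C%C.
  near: h; apply: dnbhs0_lt => //.
rewrite normcE ltcR lt_min => /andP[h1 h2].
rewrite normcE lecR nc_distC.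
rewrite [(_ : R[i]) *: _]/(_ * _) (_ : h *: 1 = h) ?[RHS]mulr1//; last by rewrite -[LHS]/(h * 1) mulr1.
rewrite (le_trans (main h h1 h0))//.
move: h2; rewrite ltr_pdivlMr// => h2; apply: le_trans (ltW h2).
by rewrite mulrC ler_wpM2l// lerDl.
Unshelve. all: by end_near.
Qed.

Lemma has_series_derive1 a f : has_series a f -> has_series (dser a) (derive1 f).
Proof.
move=> /is_derive_series[G aG h] z zd; rewrite h//; exact: aG.
Qed.

Lemma has_series0 a f : has_series a f -> f 0 = a 0%N.
Proof.
move=> af; have d0 : disc (0 : C) by apply/discE; rewrite nc0.
apply: (ccvg_unique (af 0 d0)).
rewrite -cvg_shiftS; apply: cvg_near_cst; apply: nearW => n /=.
rewrite big_nat_recl//= expr0 mulr1 big1 ?addr0// => i _.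
by rewrite exprS mul0r mulr0.
Qed.

Lemma has_series_taylor a f n : has_series a f -> taylor_coef f n = a n.
Proof.
move=> af.
have h m : has_series (iter m dser a) (derive1n m f).
  by elim: m => [//|m IH]; rewrite derive1nS /=; exact: has_series_derive1.
rewrite /taylor_coef (has_series0 (h n)).
have it m k : iter m dser a k = ((m + k)`!%:R / k`!%:R) * a (m + k)%N.
  elim: m k => [|m IH] k; first by rewrite add0n divff ?mul1r// pnatr_eq0 -lt0n fact_gt0.
  rewrite /= {1}/dser IH addSnnS (factS k) natrM.
  have f0 : (k`!%:R : C) != 0 by rewrite pnatr_eq0 -lt0n fact_gt0.
  have k0 : (k.+1%:R : C) != 0 by rewrite pnatr_eq0.
  rewrite invfM mulrA; congr (_ * _).
  by rewrite mulrCA mulVKf.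
rewrite it addn0 fact0 invr1 mulr1 mulrC mulKf// pnatr_eq0 -lt0n fact_gt0//.
Qed.

Lemma has_series_inj a b f : has_series a f -> has_series b f -> a = b.
Proof.
by move=> af bf; apply/funext => n; rewrite -(has_series_taylor n af) (has_series_taylor n bf).
Qed.

End PowerSeries.

(** * Linear factors and the Dirichlet norm of coefficient sequences *)

Section LinearFactors.
Variable R : realType.
Local Notation C := (R[i] : numClosedFieldType).
Implicit Types (x y z w u : C) (a b h c d : nat -> C) (f g : C -> C).

(* Coefficients of [(1 - c z) f]; [ldiv] is its formal inverse. *)
Definition lmul (c : C) a : nat -> C :=
  fun k => a k - c * (if k is k'.+1 then a k' else 0).

Fixpoint ldiv (c : C) a k : C :=
  a k + c * (if k is k'.+1 then ldiv c a k' else 0).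

Fixpoint lprod c n a : nat -> C :=
  if n is n'.+1 then lprod c n' (lmul (c n') a) else a.

Lemma lmul_ldiv (c : C) a : lmul c (ldiv c a) = a.
Proof. by apply/funext => -[|k] /=; rewrite /lmul /= ?mulr0 ?addr0 ?subr0// addrK. Qed.

Lemma ldiv_lmul (c : C) a : ldiv c (lmul c a) = a.
Proof.
apply/funext; elim=> [|k IH] /=; rewrite /lmul ?mulr0 ?addr0 ?subr0//.
by rewrite IH subrK.
Qed.

Lemma lmul_inj (c : C) : injective (lmul c).
Proof. exact: can_inj (ldiv_lmul c). Qed.

Lemma lmulC (c d : C) a : lmul c (lmul d a) = lmul d (lmul c a).
Proof. by apply/funext => -[|[|k]]; rewrite /lmul; ring. Qed.

Lemma lmul0 (c : C) a : lmul c a 0%N = a 0%N.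
Proof. by rewrite /lmul mulr0 subr0. Qed.

Lemma lmul0l a : lmul 0 a = a.
Proof. by apply/funext => k; rewrite /lmul mul0r subr0. Qed.

Lemma lprod_lmul c n (d : C) a : lprod c n (lmul d a) = lmul d (lprod c n a).
Proof. by elim: n d a => [//|n IH] d a /=; rewrite lmulC IH. Qed.

Lemma lprodD c m n a :
  lprod c (m + n) a = lprod c m (lprod (fun k => c (m + k)%N) n a).
Proof. by elim: n a => [|n IH] a; [rewrite addn0|rewrite addnS /= IH]. Qed.

Lemma lprod0 c n a : lprod c n a 0%N = a 0%N.
Proof. by elim: n a => [//|n IH] a /=; rewrite IH lmul0. Qed.

Lemma has_series_lmul (c : C) a f : has_series a f ->
  has_series (lmul c a) (fun z => (1 - c * z) * f z).
Proof.
move=> af z zd; have h := af z zd.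
rewrite -cvg_shiftS.
have -> : (fun n => \sum_(0 <= k < n.+1) lmul c a k * z ^+ k) =
  (fun n => \sum_(0 <= k < n.+1) a k * z ^+ k - c * z * \sum_(0 <= k < n) a k * z ^+ k).
  apply/funext => n; elim: n => [|n IH].
    by rewrite !big_nat1 big_nil /lmul; ring.
  rewrite big_nat_recr //= IH.
  rewrite [in RHS]big_nat_recr //= [\sum_(0 <= k < n.+1) _ in X in _ = _ - X]big_nat_recr //=.
  by rewrite /lmul exprS; ring.
rewrite mulrBl mul1r; apply: cvgB; first by move: h; rewrite -cvg_shiftS.
exact: cvgMl_tmp.
Qed.

Lemma has_series_lprod c n a f : has_series a f ->
  has_series (lprod c n a) (fun z => \prod_(i < n) (1 - c i * z) * f z).
Proof.
elim: n a f => [|n IH] a f af.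
  by move=> z zd; rewrite big_ord0 mul1r; exact: af.
have := IH _ _ (@has_series_lmul (c n) _ _ af); congr (has_series _ _).
by apply/funext => z; rewrite big_ord_recr /= mulrA.
Qed.

Lemma subexp_lmul (c : C) a : subexp a -> subexp (lmul c a).
Proof. by move=> /subexp_has_series[f /(@has_series_lmul c) /has_series_subexp]. Qed.

Lemma subexp_lprod c n a : subexp a -> subexp (lprod c n a).
Proof. by elim: n a => [//|n IH] a ra; apply/IH/subexp_lmul. Qed.

(* Partial sums of the squared Dirichlet norm. *)
Definition wsum a K : R := \sum_(0 <= k < K) k.+1%:R * nc (a k) ^+ 2.
Definition wle a (B : R) := forall K, wsum a K <= B.

Lemma wsumS a K : wsum a K.+1 = wsum a K + K.+1%:R * nc (a K) ^+ 2.
Proof. by rewrite /wsum big_nat_recr. Qed.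

Lemma wsum_ge0 a K : 0 <= wsum a K.
Proof. by apply: sumr_ge0 => k _; rewrite mulr_ge0 ?sqr_ge0. Qed.

Lemma wsum_mono a m n : (m <= n)%N -> wsum a m <= wsum a n.
Proof.
move=> mn; rewrite /wsum [leRHS](@big_cat_nat _ _ _ m)//= lerDl.
by apply: sumr_ge0 => k _; rewrite mulr_ge0 ?sqr_ge0.
Qed.

Lemma wle_nc a B k : wle a B -> nc (a k) ^+ 2 <= B.
Proof.
move=> /(_ k.+1); apply: le_trans; rewrite wsumS.
rewrite -[leLHS]add0r lerD ?wsum_ge0//.
by rewrite ler_peMl ?sqr_ge0// ler1n.
Qed.

Lemma wle_nc1 a B k : wle a B -> nc (a k) <= B + 1.
Proof.
move=> aB; have h := wle_nc k aB.
have B0 : 0 <= B by apply: le_trans h; rewrite sqr_ge0.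
rewrite -(@ler_pXn2r _ 2)// ?nnegrE ?addr_ge0// (le_trans h)//.
nra.
Qed.

(** The weighted squares (k + 1) |a_k|^2 are the moduli of the coefficients of the derivative of the
    series with terms a_k^2 z^(k+1), which converges on the disc. *)
Lemma wsum_growth a (th : R) : subexp a -> 0 <= th < 1 ->
  exists M, forall K, wsum a K * th ^+ K <= M.
Proof.
move=> ra /andP[th0 th1].
pose b : nat -> C := fun k => if k is k'.+1 then a k' ^+ 2 else 0.
have rb : subexp b.
  move=> rho /andP[r0 r1].
  have [|M hM] := ra (Num.sqrt rho).
    by rewrite sqrtr_ge0 -sqrtr1 ltr_sqrt.
  exists (M ^+ 2) => -[|k] /=.
    by rewrite nc0 mul0r sqr_ge0.
  have -> : nc (a k ^+ 2) * rho ^+ k.+1 = (nc (a k) * Num.sqrt rho ^+ k) ^+ 2 * rho.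
    by rewrite exprMn exprAC (sqr_sqrtr r0) ncX (exprSr rho) mulrA.
  rewrite -[leRHS]mulr1 ler_pM ?sqr_ge0 ?(ltW r1)//.
  by rewrite lerXn2r ?nnegrE ?mulr_ge0 ?exprn_ge0 ?sqrtr_ge0// (le_trans _ (hM 0%N))// mulr_ge0.
have [|M hM] := @subexp_sum _ _ th (subexp_dser rb); first by rewrite th0.
exists M => K; apply: le_trans (hM K).
rewrite /wsum mulr_suml big_nat_cond [leRHS]big_nat_cond.
apply: ler_sum => k /andP[/andP[_ kK] _].
rewrite /dser /= ncM nc_nat ncX ler_wpM2l ?mulr_ge0 ?sqr_ge0//.
by apply: ler_wiXn2l; rewrite ?(ltW th1)// ltnW.
Qed.

(* The comparison of truncated norms in [wsum_ray] has the error term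
   [wsum h K.+1]; this provides truncations at which it is harmless, without
   knowing that [h] itself has finite norm. *)
Lemma growth_ratio (A : nat -> R) (q : R) (K0 : nat) : (forall K, 0 <= A K) ->
  (forall th : R, 0 <= th < 1 -> exists M, forall K, A K * th ^+ K <= M) ->
  1 < q -> exists2 K, (K0 <= K)%N & A K.+1 <= q * A K.
Proof.
move=> A0 hA q1; apply: contrapT => /forall2NP hn.
have step K : (K0 <= K)%N -> q * A K < A K.+1.
  by move=> K0K; have [//|/negP] := hn K; rewrite -ltNge.
have q0 : 0 < q by lra.
have lt1 j : A K0.+1 * q ^+ j <= A (K0.+1 + j)%N.
  elim: j => [|j IH]; first by rewrite addn0 expr0 mulr1.
  rewrite addnS exprS mulrCA (le_trans _ (ltW (step _ _)))//; last by rewrite addSn ltnW// ltnS leq_addr.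
  by rewrite ler_pM2l.
have al0 : 0 < A K0.+1 by apply: le_lt_trans (step K0 _) => //; rewrite mulr_ge0// ltW.
(* If every ratio from K0 on exceeded q, A would grow like q^j. As th lies between 1/q and 1, q * th
   > 1, and A K * th^K would be unbounded. *)
pose th := (1 + q^-1) / 2.
have qi : q^-1 < 1 by rewrite invf_lt1.
have qi0 : 0 < q^-1 by rewrite invr_gt0.
have [|M hM] := hA th; first by rewrite /th; lra.
have th0 : 0 < th by rewrite /th; lra.
have qth : 1 < q * th by rewrite /th mulrA mulrDr mulr1 mulfV; lra.
pose x := (q * th)^-1.
have x01 : `|x| < 1 by rewrite ger0_norm ?invr_ge0 ?invf_lt1; lra.
have := cvg_expr x01; move=> /cvgrPdist_lt xn.
pose M' := `|M| + 1.
have M'0 : 0 < M' by rewrite /M'; have := normr_ge0 M; lra.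
have e0 : 0 < A K0.+1 * th ^+ K0.+1 / M' by rewrite divr_gt0// mulr_gt0// exprn_gt0.
have [N _ /(_ N (leqnn N))] := xn _ e0.
rewrite /= sub0r normrN normrX (ger0_norm (_ : 0 <= x)); last first.
  by rewrite invr_ge0; lra.
rewrite ltr_pdivlMr//.
have xN : 0 < (q * th) ^+ N by rewrite exprn_gt0//; lra.
rewrite /x exprVn mulrC ltr_pdivrMr// => H.
have := hM (K0.+1 + N)%N.
have := lt1 N; move=> /(ler_wpM2r (_ : 0 <= th ^+ (K0.+1 + N))).
move=> /(_ (ltW (exprn_gt0 _ th0))) H1 H2; move: (le_trans H1 H2).
have -> : A K0.+1 * q ^+ N * th ^+ (K0.+1 + N) = A K0.+1 * th ^+ K0.+1 * (q * th) ^+ N.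
  by rewrite exprD [(q * th) ^+ N]exprMn mulrACA.
rewrite leNgt => /negP; apply; apply: lt_trans H.
by rewrite /M'; have := ler_norm M; lra.
Qed.

(** The right-hand side is (g - d) ((g + d) |y|^2 - 2 Re<x, y>), and 2 Re<x, y> is at most |x|^2 +
    |y|^2. *)
Lemma sqr_ncB_ray x y (g d : R) : d <= g ->
  (g - d) * ((g + d - 1) * nc y ^+ 2 - nc x ^+ 2) <=
  nc (x - g%:C%C * y) ^+ 2 - nc (x - d%:C%C * y) ^+ 2.
Proof.
case: x y => x1 x2 [y1 y2] dg; rewrite !sqr_nc /sqrnorm /=.
have p (s t : R) : (g - d) * ((g + d - 1) * t ^+2 - s ^+2) <= (s - g * t)^+2 - (s - d * t) ^+2.
  rewrite -subr_ge0.
  have -> : (s - g * t)^+2 - (s - d * t) ^+2 - (g - d) * ((g + d - 1) * t ^+2 - s ^+2)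
     = (g - d) * (s - t)^+2 by ring.
  by rewrite mulr_ge0 ?sqr_ge0 ?subr_ge0.
have := p x1 y1; have := p x2 y2; rewrite !mul0r !subr0 !addr0; lra.
Qed.

(** Sums [sqr_ncB_ray] for x = h_(k+1) and y = u h_k with weight k + 2. Lowering the weight of
    |h_k|^2 from k + 2 to k + 1 is the inequality between the norms of z h and h; the shift by z
    also explains the two truncations K and K + 1. *)
Lemma wsum_ray h u (g d : R) K : nc u = 1 -> 1 <= d <= g ->
  (g - d) * ((g + d - 1) * wsum h K - wsum h K.+1) <=
  wsum (lmul (g%:C%C * u) h) K.+1 - wsum (lmul (d%:C%C * u) h) K.+1.
Proof.
move=> u1 /andP[d1 dg]; have gd : 0 <= g - d by rewrite subr_ge0.
elim: K => [|K IH].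
  rewrite /wsum big_nil !big_nat1 !lmul0 subrr mulr0 add0r.
  by rewrite mulrN oppr_le0 !mulr_ge0 ?sqr_ge0.
rewrite [wsum (lmul (g%:C%C * u) h) _]wsumS [wsum (lmul (d%:C%C * u) h) _]wsumS.
rewrite [wsum h K.+2]wsumS {1}[wsum h K.+1]wsumS.
have := sqr_ncB_ray (h K.+1) (u * h K) dg.
rewrite (ncM u) u1 mul1r {2 4}/lmul -!mulrA => H.
have H2 : (g - d) * ((g + d - 1) * (K.+1%:R * nc (h K) ^+ 2) - K.+2%:R * nc (h K.+1) ^+ 2) <=
  K.+2%:R * nc (h K.+1 - g%:C%C * (u * h K)) ^+ 2 -
  K.+2%:R * nc (h K.+1 - d%:C%C * (u * h K)) ^+ 2.
  rewrite -mulrBr; apply: le_trans (ler_wpM2l (ler0n _ K.+2) H).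
  rewrite [leRHS]mulrCA; apply: ler_wpM2l => //.
  rewrite [leRHS]mulrBr lerD2r [leLHS]mulrCA; apply: ler_wpM2r; last by rewrite ler_nat.
  by rewrite mulr_ge0 ?sqr_ge0//; lra.
lra.
Qed.

Lemma wle_ray h u (g d B : R) : subexp h -> nc u = 1 -> 1 < d <= g ->
  wle (lmul (g%:C%C * u) h) B -> wle (lmul (d%:C%C * u) h) B.
Proof.
move=> rh u1 /andP[d1 dg] hB K.
(* Since d > 1, the ratio g + d - 1 exceeds 1; at the truncation K' the lower bound of [wsum_ray] is
   nonnegative. *)
have [|K' KK' hK'] := growth_ratio K (wsum_ge0 h) (fun th => wsum_growth rh) (_ : 1 < g + d - 1).
  by lra.
apply: (le_trans (wsum_mono _ (leqW KK'))); apply: le_trans (hB K'.+1).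
rewrite -subr_ge0; apply: le_trans (wsum_ray h K' u1 _); last by rewrite ltW.
by rewrite mulr_ge0 ?subr_ge0.
Qed.

Lemma sqr_ncB_le x y : nc (x - y) ^+ 2 <= 2 * nc x ^+ 2 + 2 * nc y ^+ 2.
Proof.
apply: (@le_trans _ _ ((nc x + nc y) ^+ 2)).
  by rewrite lerXn2r ?nnegrE ?addr_ge0// ler_ncB.
rewrite -subr_ge0.
have -> : 2 * nc x ^+ 2 + 2 * nc y ^+ 2 - (nc x + nc y) ^+ 2 = (nc x - nc y) ^+ 2 by ring.
exact: sqr_ge0.
Qed.

(* [h] is recovered from the difference of [(1 - c z) h] and [(1 - c' z) h],
   both of finite norm by [wle_ray]. *)
Lemma wle_lmulV h u (g B : R) : subexp h -> nc u = 1 -> 1 < g ->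
  wle (lmul (g%:C%C * u) h) B -> exists B', wle h B'.
Proof.
move=> rh u1 g1 hB; pose d := (1 + g) / 2.
have dB : wle (lmul (d%:C%C * u) h) B by apply: (wle_ray rh u1 _ hB); rewrite /d; lra.
have gd : 0 < (g - d) ^+ 2 by rewrite exprn_gt0//; rewrite /d; lra.
(* The two products differ by (g - d) u z h, whose squared norm is at most 2 B + 2 B. *)
exists (4 * B / (g - d) ^+ 2) => K; rewrite ler_pdivlMr//.
apply: (@le_trans _ _ (2 * wsum (lmul (d%:C%C * u) h) K.+1 + 2 * wsum (lmul (g%:C%C * u) h) K.+1)); last first.
  by have := hB K.+1; have := dB K.+1; lra.
rewrite /wsum !mulr_sumr -big_split /= mulr_suml big_nat_recl//=.
rewrite -[leLHS]add0r lerD//.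
  by rewrite addr_ge0// mulr_ge0// mulr_ge0// sqr_ge0.
apply: ler_sum => k _.
have := sqr_ncB_le (lmul (d%:C%C * u) h k.+1) (lmul (g%:C%C * u) h k.+1).
rewrite /lmul.
have -> : h k.+1 - d%:C%C * u * h k - (h k.+1 - g%:C%C * u * h k) = (g - d)%:C%C * u * h k.
  by rewrite rmorphB /=; ring.
rewrite !ncM u1 mulr1 nc_real exprMn real_normK ?num_real//.
set Y := nc (h k) ^+ 2; set X := nc _ ^+ 2; set Z := nc _ ^+ 2 => H.
apply: (@le_trans _ _ (k.+2%:R * ((g - d) ^+ 2 * Y))).
  rewrite -mulrA [Y * _]mulrC ler_wpM2r// ?ler_nat//.
  by rewrite mulr_ge0 ?sqr_ge0.
apply: le_trans (ler_wpM2l (ler0n _ k.+2) H) _.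
lra.
Qed.

Lemma wle_lmul h (c : C) B : wle h B -> exists B', wle (lmul c h) B'.
Proof.
move=> hB; exists (2 * B + 4 * nc c ^+ 2 * B).
have step K : wsum (lmul c h) K.+1 <= 2 * wsum h K.+1 + 4 * nc c ^+ 2 * wsum h K.
  elim: K => [|K IH].
    rewrite /wsum big_nil !big_nat1 lmul0 mulr0 addr0 ler_peMl ?ler1n//.
    by rewrite mulr_ge0 ?sqr_ge0.
  rewrite wsumS [wsum h K.+2]wsumS [X in _ <= _ + _ * X]wsumS.
  have H : K.+2%:R * nc (lmul c h K.+1) ^+ 2 <= 2 * (K.+2%:R * nc (h K.+1) ^+ 2) +
     4 * nc c ^+ 2 * (K.+1%:R * nc (h K) ^+ 2).
    rewrite /lmul; have := sqr_ncB_le (h K.+1) (c * h K); rewrite ncM exprMn.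
    move=> /(ler_wpM2l (ler0n R K.+2)) H; apply: le_trans H _.
    have -> : K.+2%:R * (2 * nc (h K.+1) ^+ 2 + 2 * (nc c ^+ 2 * nc (h K) ^+ 2)) =
      2 * (K.+2%:R * nc (h K.+1) ^+ 2) + K.+2%:R * 2 * (nc c ^+ 2 * nc (h K) ^+ 2) by ring.
    have -> : 4 * nc c ^+ 2 * (K.+1%:R * nc (h K) ^+ 2) = (K.+1%:R * 4) * (nc c ^+ 2 * nc (h K) ^+ 2).
      by ring.
    rewrite lerD2l ler_wpM2r ?mulr_ge0 ?sqr_ge0// -!natrM ler_nat.
    by lia.
  lra.
case=> [|K]; last first.
  by apply: le_trans (step K) _; rewrite lerD// ler_wpM2l// ?mulr_ge0 ?sqr_ge0.
have B0 : 0 <= B by apply: le_trans (hB 0%N); rewrite wsum_ge0.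
by rewrite /wsum big_nil addr_ge0// !mulr_ge0// sqr_ge0.
Qed.

End LinearFactors.

(** * Moving zeros *)

Section MovingZeros.
Variable R : realType.
Local Notation C := (R[i] : numClosedFieldType).
Implicit Types (x y z w u : C) (a b : nat -> C) (c d : nat -> C) (f g : C -> C)
  (h : nat -> nat -> C).

(* The inverses of a zero and of its new position; the case [g = d = 0] stands
   for the indices outside the sequence. *)
Definition same_ray (x y : C) := exists u (g d : R),
  [/\ nc u = 1, x = g%:C%C * u, y = d%:C%C * u & (1 < d <= g) \/ (g = 0 /\ d = 0)].

(** h n is h 0 divided by the first n factors. Formal quotients always exist; [subexp] is what says
    that these factors divide among analytic functions. *)
Definition quotients c h := forall n, subexp (h n) /\ h n = lmul (c n) (h n.+1).

(* For [quotients c h], the coefficients of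
   [f * \prod_(i < n) (1 - d i * z) / (1 - c i * z)]. *)
Definition moved d h n := lprod d n (h n).

Lemma lprod_cvg d n (G : nat -> nat -> C) a :
  (forall k, G^~ k @ \oo --> a k) ->
  forall k, (fun m => lprod d n (G m) k) @ \oo --> lprod d n a k.
Proof.
elim: n G a => [//|n IH] G a Ga /=; apply: IH => k; rewrite /lmul.
apply: cvgB; first exact: Ga.
apply: cvgMl_tmp; case: k => [|k]; [exact: cvg_cst|exact: Ga].
Qed.

Lemma cvg_nc (u : nat -> C) (l : C) : u @ \oo --> l ->
  nc (u n) @[n --> \oo] --> nc l.
Proof.
move=> /ccvgP ul; apply/cvgrPdist_le => e e0.
move/cvgrPdist_le : ul => /(_ _ e0); apply: filterS => n.
rewrite sub0r normrN (ger0_norm (nc_ge0 _)) => h.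
rewrite ler_distlC; have := ler_nc_sub (u n) l; have := ler_nc_sub l (u n).
by have := nc_distC (u n) l; lra.
Qed.

(** Lower semicontinuity of the norm: each inequality in [wle] involves finitely many
    coefficients. *)
Lemma wle_cvg (G : nat -> nat -> C) a B : (forall n, wle (G n) B) ->
  (forall k, G^~ k @ \oo --> a k) -> wle a B.
Proof.
move=> GB Ga K.
have : wsum (G n) K @[n --> \oo] --> wsum a K.
  elim: K => [|K IH]; first by rewrite /wsum big_nil; under eq_fun do rewrite big_nil; exact: cvg_cst.
  under eq_fun do rewrite wsumS; rewrite wsumS; apply: cvgD => //.
  by apply: cvgMl_tmp; under eq_fun do rewrite expr2; rewrite expr2; apply: cvgM; exact: cvg_nc.
move=> H; rewrite -(cvg_lim _ H)//; apply: limr_le; first by apply/cvg_ex; exists (wsum a K).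
by apply: nearW => n; exact: GB.
Qed.

Section Family.
Variables (c d : nat -> C) (h : nat -> nat -> C).
Hypothesis cd : forall n, same_ray (c n) (d n).
Hypothesis hq : quotients c h.

(** The common part of two consecutive functions: [moved] at n and n + 1 are its products by 1 - c_n
    z and 1 - d_n z. *)
Let g n := lprod d n (h n.+1).

Let subexp_g n : subexp (g n).
Proof. by apply: subexp_lprod; case: (hq n.+1). Qed.

Lemma movedE n : moved d h n = lmul (c n) (g n).
Proof. by rewrite /moved (hq n).2 lprod_lmul. Qed.

Lemma movedS n : moved d h n.+1 = lmul (d n) (g n).
Proof. by rewrite /moved /= lprod_lmul. Qed.

Lemma moved_wle n B : wle (h 0%N) B -> wle (moved d h n) B.
Proof.
move=> hB; elim: n => [//|n]; rewrite movedE movedS.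
have [u [y [e [u1 -> -> [yd|[-> ->]]]]]] := cd n; last by [].
exact: wle_ray.
Qed.

(** B' depends on n, which is enough to restart the whole construction from h N. *)
Lemma quotients_wle n B : wle (h 0%N) B -> exists B', wle (h n) B'.
Proof.
move=> hB; elim: n => [|n [B' hB']]; first by exists B.
have [rh hE] := hq n; have [rh1 _] := hq n.+1.
move: hB'; rewrite hE.
have [u [y [e [u1 -> _ [yd|[-> _]]]]]] := cd n.
  by apply: wle_lmulV => //; lra.
by rewrite mul0r lmul0l => ?; exists B'.
Qed.

Lemma quotients0 n : h n 0%N = h 0%N 0%N.
Proof. by elim: n => [//|n <-]; rewrite (hq n).2 lmul0. Qed.

Lemma moved0 n : moved d h n 0%N = h 0%N 0%N.
Proof. by rewrite /moved lprod0 quotients0. Qed.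

(** One move changes coefficient k by d_n - c_n, up to sign, times coefficient k - 1 of [g n]. For
    fixed k these coefficients are bounded uniformly in n, so the changes are summable. *)
Lemma moved_cvg (S : R) B : wle (h 0%N) B ->
  (forall n, \sum_(0 <= k < n) nc (c k - d k) <= S) ->
  (exists G : R, forall n, nc (c n) <= G) ->
  exists a, forall k, (moved d h)^~ k @ \oo --> a k.
Proof.
move=> hB hS [G hG].
pose M := B + 1.
have mM n k : nc (moved d h n k) <= M by apply/wle_nc1/moved_wle.
have M0 : 0 <= M by apply: le_trans (mM 0%N 0%N).
have G0 : 0 <= G by apply: le_trans (hG 0%N).
(* Majorant of the recursion that defines [ldiv], with |c n| replaced by G and the coefficients of
   [moved] by M. *)
pose T k := iter k (fun t => M + G * t) M.
have T0 k : 0 <= T k.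
  by case: k => [//|k]; rewrite /T; elim: k.+1 => [//|j IH] /=; rewrite addr_ge0 ?mulr_ge0.
have gT n k : nc (g n k) <= T k.
  have <- : ldiv (c n) (moved d h n) = g n by rewrite movedE ldiv_lmul.
  elim: k => [|k IH]; first by rewrite /= mulr0 addr0.
  rewrite [ldiv _ _ _]/= (le_trans (ler_ncD _ _))// lerD// ncM ler_pM//.
have step n k : nc (moved d h n.+1 k - moved d h n k) <= nc (c n - d n) * (if k is k'.+1 then T k' else 0).
  rewrite movedS movedE /lmul.
  have -> : forall p q r s : C, p - q * r - (p - s * r) = (s - q) * r by move=> p q r s; ring.
  rewrite ncM ler_wpM2l//; case: k => [|k]; [by rewrite nc0|exact: gT].
have ex k : exists l : C, (moved d h)^~ k @ \oo --> l.
  have [|l hl] := @cvg_abs_cseries R (fun n => moved d h n.+1 k - moved d h n k)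
     (S * (if k is k'.+1 then T k' else 0)).
    move=> n; apply: (@le_trans _ _ (\sum_(0 <= j < n) nc (c j - d j) * (if k is k'.+1 then T k' else 0))).
      by apply: ler_sum => j _.
    by rewrite -mulr_suml ler_wpM2r//; case: (k).
  exists (l + moved d h 0%N k).
  have -> : (moved d h)^~ k = (fun n => \sum_(0 <= j < n) (moved d h j.+1 k - moved d h j k) + moved d h 0%N k).
    by apply/funext => n; rewrite telescope_sumr// subrK.
  exact: (cvgD hl (cvg_cst _)).
by have [a ha] := choice ex; exists a.
Qed.

End Family.

Section Tail.
Variables (c d : nat -> C) (h : nat -> nat -> C) (N : nat).

Let cN n := c (N + n)%N.
Let dN n := d (N + n)%N.
Let hN n := h (N + n)%N.

Lemma quotients_shift : quotients c h -> quotients cN hN.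
Proof. by move=> hq n; have := hq (N + n)%N; rewrite /hN addnS. Qed.

Lemma moved_shift n : moved d h (N + n) = lprod d N (moved dN hN n).
Proof. by rewrite /moved lprodD. Qed.

(** Exhibits the first N new factors as genuine factors of the limit; the cofactor is the limit of
    the process started at h N. *)
Lemma moved_cvg_shift a b :
  (forall k, (moved d h)^~ k @ \oo --> a k) ->
  (forall k, (moved dN hN)^~ k @ \oo --> b k) -> a = lprod d N b.
Proof.
move=> ha hb; apply/funext => k.
apply: (@ccvg_unique _ (fun n => moved d h (n + N)%N k)).
  by have := ha k; rewrite -(cvg_shiftn N).
have -> : (fun n => moved d h (n + N)%N k) = (fun n => lprod d N (moved dN hN n) k).
  by apply/funext => n; rewrite addnC moved_shift.
exact: lprod_cvg.
Qed.

End Tail.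

End MovingZeros.

(** * Nonvanishing of the limit, and the Blaschke condition *)

Section Nonvanishing.
Variable R : realType.
Local Notation C := (R[i] : numClosedFieldType).
Implicit Types (x y z w u : C) (a b : nat -> C) (c d : nat -> C) (f g : C -> C)
  (h : nat -> nat -> C).

Lemma has_series_tail a f z (M : R) K : has_series a f -> disc z ->
  (forall k, nc (a k) <= M) ->
  nc (f z - \sum_(0 <= k < K) a k * z ^+ k) <= M * nc z ^+ K * (1 - nc z)^-1.
Proof.
move=> af zd aM.
apply: (@cvg_nc_le _ (fun n => \sum_(0 <= k < n + K) a k * z ^+ k - \sum_(0 <= k < K) a k * z ^+ k)).
  by apply: cvgB; [have := af z zd; rewrite -(cvg_shiftn K)|exact: cvg_cst].
move=> n; rewrite (@big_cat_nat _ _ _ K)//= ?leq_addl// addrAC subrr add0r.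
rewrite (le_trans (ler_nc_sum _ _ _))//.
have M0 : 0 <= M by apply: le_trans (aM 0%N).
rewrite -{1}[K]add0n big_addn addnK.
apply: (@le_trans _ _ (\sum_(0 <= k < n) M * nc z ^+ K * nc z ^+ k)).
  apply: ler_sum => k _; rewrite ncM ncX exprD -mulrA [nc z ^+ K * _]mulrC.
  by rewrite ler_wpM2r// mulr_ge0 ?exprn_ge0.
by rewrite -mulr_sumr ler_wpM2l ?mulr_ge0 ?exprn_ge0// geo_sum_le// nc_ge0; apply/discE.
Qed.

(** The common bound M makes the tails at z small uniformly in n, which leaves finitely many
    coefficients. *)
Lemma has_series_cvg (G : nat -> nat -> C) (F : nat -> C -> C) a f z (M : R) :
  (forall n, has_series (G n) (F n)) -> has_series a f -> disc z ->
  (forall n k, nc (G n k) <= M) -> (forall k, G^~ k @ \oo --> a k) ->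
  (fun n => F n z) @ \oo --> f z.
Proof.
move=> GF af zd GM Ga.
have aM k : nc (a k) <= M by apply: cvg_nc_le (Ga k) _.
have z1 : nc z < 1 by apply/discE.
have M0 : 0 <= M by apply: le_trans (GM 0%N 0%N).
have ps K : (fun n => \sum_(0 <= k < K) G n k * z ^+ k) @ \oo --> (\sum_(0 <= k < K) a k * z ^+ k : C).
  elim: K => [|K IH]; first by rewrite big_nil; under eq_fun do rewrite big_nil; exact: cvg_cst.
  have E (b : nat -> C) : \sum_(0 <= k < K.+1) b k * z ^+ k = \sum_(0 <= k < K) b k * z ^+ k + b K * z ^+ K.
    by rewrite big_nat_recr.
  rewrite E; under eq_fun do rewrite E.
  by apply: (cvgD IH); apply: cvgMr_tmp; exact: Ga.
apply/ccvgP/cvgrPdist_lt => e e0.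
have [K hK] : exists K, M * nc z ^+ K * (1 - nc z)^-1 < e / 3.
  have x01 : `|nc z| < 1 by rewrite ger0_norm.
  have : M * nc z ^+ K * (1 - nc z)^-1 @[K --> \oo] --> M * 0 * (1 - nc z)^-1.
    by apply: cvgMr_tmp; apply: cvgMl_tmp; exact: cvg_expr.
  rewrite mulr0 mul0r => /cvgrPdist_lt /(_ (e / 3)) [|N _ /(_ N (leqnn N))]; first by rewrite divr_gt0.
  by rewrite /= sub0r normrN => H; exists N; apply: le_lt_trans (ler_norm _) H.
have /ccvgP/cvgrPdist_lt/(_ (e / 3)) := ps K.
move=> /(_ ltac:(rewrite divr_gt0//)); apply: filterS => n.
rewrite !sub0r !normrN !(ger0_norm (nc_ge0 _)) => H.
have t1 := has_series_tail K (GF n) zd (GM n).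
have t2 := has_series_tail K af zd aM.
set p := \sum_(0 <= k < K) G n k * z ^+ k in H t1.
set q := \sum_(0 <= k < K) a k * z ^+ k in H t2.
have -> : F n z - f z = (F n z - p) + (p - q) - (f z - q) by ring.
apply: le_lt_trans (ler_ncB _ _) _.
have := ler_ncD (F n z - p) (p - q); lra.
Qed.

(** Each move multiplies the modulus at z by at least 1 - |c_n - d_n| / sg, because |1 - d_n z| >=
    |1 - c_n z| - |c_n - d_n|. The product of these numbers is at least 1 minus the sum of the
    quotients, hence at least 1/2. *)
Lemma moved_nonvanishing c d h a f0 f z (M sg : R) :
  quotients c h -> disc z -> 0 < sg ->
  (forall n, sg <= nc (1 - c n * z)) ->
  (forall n, \sum_(0 <= k < n) nc (c k - d k) <= sg / 2) ->
  (forall n k, nc (moved d h n k) <= M) ->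
  (forall k, (moved d h)^~ k @ \oo --> a k) ->
  has_series (h 0%N) f0 -> has_series a f ->
  nc (f0 z) / 2 <= nc (f z).
Proof.
move=> hq zd sg0 hsg hS hM ha hf0 hf.
have exG n : exists G, has_series (lprod d n (h n.+1)) G.
  by apply/subexp_has_series/subexp_lprod; case: (hq n.+1).
have [G GP] := choice exG.
pose F n : C -> C := if n is n'.+1 then fun z => (1 - d n' * z) * G n' z else f0.
have FP n : has_series (moved d h n) (F n).
  case: n => [|n]; first exact: hf0.
  by rewrite movedS; exact: (@has_series_lmul _ (d n) _ _ (GP n)).
have FE n : F n z = (1 - c n * z) * G n z.
  apply: (ccvg_unique (FP n z zd)); rewrite (movedE d hq).
  exact: (@has_series_lmul _ (c n) _ _ (GP n) z zd).
have lb n : nc (f0 z) * (1 - (\sum_(0 <= k < n) nc (c k - d k)) / sg) <= nc (F n z).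
  elim: n => [|n IH]; first by rewrite big_nil mul0r subr0 mulr1.
  rewrite big_nat_recr //=; set s := \sum_(0 <= k < n) _ in IH *.
  set e := nc (c n - d n).
  have e0 : 0 <= e by exact: nc_ge0.
  have s0 : 0 <= s by apply: sumr_ge0.
  have := FE n => FEn.
  have z1 : nc z < 1 by apply/discE.
  have H1 : nc (1 - c n * z) - e <= nc (1 - d n * z).
    have := ler_nc_sub (1 - c n * z) ((d n - c n) * z).
    have -> : 1 - c n * z - (d n - c n) * z = 1 - d n * z by ring.
    rewrite ncM nc_distC -/e => H; apply: le_trans H; rewrite lerD2l lerN2.
    by rewrite ler_piMr// ltW.
  have H2 : nc (F n z) * (1 - e / sg) <= nc ((1 - d n * z) * G n z).
    rewrite ncM; apply: le_trans (ler_wpM2r (nc_ge0 _) H1).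
    rewrite FEn ncM -mulrA [nc (G n z) * _]mulrC mulrA ler_wpM2r//.
    rewrite mulrBr mulr1 lerD2l lerN2 mulrCA ler_peMr//.
    by rewrite ler_pdivlMr ?mul1r.
  (* If e exceeds sg the factor 1 - e / sg is negative, but then so is the claimed lower bound. *)
  have [es|es] := leP (e / sg) 1; last first.
    apply: (@le_trans _ _ 0); last exact: nc_ge0.
    rewrite mulr_ge0_le0//.
    have : 0 <= s / sg by rewrite divr_ge0// ltW.
    by rewrite mulrDl; lra.
  apply: le_trans H2; apply: le_trans (ler_wpM2r _ IH); last by lra.
  rewrite -mulrA ler_wpM2l//.
  have : 0 <= s / sg * (e / sg) by rewrite !mulr_ge0// ?invr_ge0 ltW.
  by rewrite mulrDl; lra.
have cF := cvg_nc (has_series_cvg FP hf zd hM ha).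
rewrite -(cvg_lim _ cF)//; apply: limr_ge; first by apply/cvg_ex; eexists; exact: cF.
apply: nearW => n; apply: le_trans (lb n); rewrite ler_wpM2l//.
have : (\sum_(0 <= k < n) nc (c k - d k)) / sg <= 2^-1.
  by rewrite ler_pdivrMr// mulrC; exact: hS.
by lra.
Qed.

(** Partial sums of the squared Hardy norm. *)
Definition hsum a K : R := \sum_(0 <= k < K) nc (a k) ^+ 2.

Lemma hsum_le_wsum a K : hsum a K <= wsum a K.
Proof. by apply: ler_sum => k _; rewrite ler_peMl ?sqr_ge0// ler1n. Qed.

(* Moving the zero [1 / (y u)] to its reflection in the circle; the last term is
   the error due to truncation. *)
Lemma hsum_reflect (g : nat -> C) u (y : R) K : nc u = 1 -> y != 0 ->
  y ^+ 2 * hsum (lmul ((y^-1)%:C%C * u) g) K.+1 =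
  hsum (lmul (y%:C%C * u) g) K.+1 + (y ^+ 2 - 1) * nc (g K) ^+ 2.
Proof.
move=> u1 y0.
(* For s = g_(k+1) and t = u g_k the last terms telescope, as |u| = 1. *)
have P (s t : C) : y ^+ 2 * nc (s - y^-1%:C%C * t) ^+ 2 =
   nc (s - y%:C%C * t) ^+ 2 + (y ^+ 2 - 1) * (nc s ^+ 2 - nc t ^+ 2).
  case: s t => s1 s2 [t1 t2]; rewrite !sqr_nc /sqrnorm /=; field.
  exact: y0.
elim: K => [|K IH].
  by rewrite /hsum !big_nat1 !lmul0; ring.
have hsumS b k : hsum b k.+1 = hsum b k + nc (b k) ^+ 2 by rewrite /hsum big_nat_recr.
rewrite hsumS [in RHS]hsumS mulrDr IH.
have := P (g K.+1) (u * g K); rewrite (ncM u) u1 mul1r !mulrA => E.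
by rewrite {2}/lmul E {3}/lmul; ring.
Qed.

(** Finite Dirichlet norm gives (m + 1) |g_m|^2 <= B', so the truncation error of [hsum_reflect]
    tends to 0. *)
Lemma hsum_ray (g : nat -> C) u (y B B' : R) : nc u = 1 -> 1 < y -> wle g B' ->
  (forall K, hsum (lmul (y%:C%C * u) g) K <= B) ->
  forall K, y ^+ 2 * hsum (lmul ((y^-1)%:C%C * u) g) K <= B.
Proof.
move=> u1 y1 gB hB K; apply/ler_addgt0Pr => e e0.
have y2 : 0 < y ^+ 2 - 1 by rewrite subr_gt0 exprn_egt1.
have B0 : 0 <= B' by apply: le_trans (gB 0%N); exact: wsum_ge0.
pose n := Num.truncn ((y ^+ 2 - 1) * B' / e).
have hn : (y ^+ 2 - 1) * B' / e < n.+1%:R.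
  by apply: truncnS_gt.
pose m := maxn K n.
apply: (@le_trans _ _ (y ^+ 2 * hsum (lmul ((y^-1)%:C%C * u) g) m.+1)).
  rewrite ler_wpM2l ?sqr_ge0// /hsum [leRHS](@big_cat_nat _ _ _ K)//=.
    by rewrite lerDl sumr_ge0// => k _; rewrite sqr_ge0.
  by rewrite (leq_trans (leq_maxl _ n)).
rewrite hsum_reflect ?gt_eqF//; last lra.
rewrite lerD//.
have gm : m.+1%:R * nc (g m) ^+ 2 <= B'.
  by apply: le_trans (gB m.+1); rewrite wsumS lerDr wsum_ge0.
have nm : n.+1%:R <= m.+1%:R :> R by rewrite ler_nat ltnS leq_maxr.
rewrite -(@ler_pM2l _ m.+1%:R)// mulrCA.
apply: (le_trans (ler_wpM2l (ltW y2) gm)).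
rewrite ltr_pdivrMr// in hn; apply: (le_trans (ltW hn)).
by rewrite ler_wpM2r// ltW.
Qed.

(** After n reflections the squared Hardy norm times the product of the |c_k|^2 is still at most B.
    Coefficient 0 never changes, so this product is at most B / |h_0(0)|^2. *)
Lemma blaschke c h B :
  (forall n, exists u (y : R), [/\ nc u = 1, c n = y%:C%C * u & 1 < y \/ y = 0]) ->
  quotients c h -> wle (h 0%N) B -> h 0%N 0%N != 0 ->
  exists S : R, forall n, \sum_(0 <= k < n) (if c k == 0 then 0 else nc (c k) - 1) <= S.
Proof.
move=> hc hq hB h00.
(* The inverse of the reflected zero: 1/y times u if c n is y times u. For c n = 0 it is 0. *)
pose d n := ((nc (c n) ^+ 2)^-1)%:C%C * c n.
pose p n := if c n == 0 then 1 else nc (c n).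
(* Reflections are not covered by [wle_ray], so finiteness of the Dirichlet norm is carried along,
   with a bound depending on n; [hsum_ray] needs only that. *)
have main n : (exists B', wle (moved d h n) B') /\
    forall K, \prod_(0 <= k < n) p k ^+ 2 * hsum (moved d h n) K <= B.
  elim: n => [|n [[B' hB'] IH]].
    split; first by exists B.
    by move=> K; rewrite big_nil mul1r (le_trans (hsum_le_wsum _ _)).
  rewrite movedS; rewrite (movedE d hq) in hB' IH.
  set g := lprod d n (h n.+1) in hB' IH *.
  have rg : subexp g by apply: subexp_lprod; case: (hq n.+1).
  have [u [y [u1 cE [y1|y0]]]] := hc n; last first.
    have c0 : c n = 0 by rewrite cE y0 mul0r.
    rewrite /d c0 mulr0 lmul0l in hB' IH *; split; first by exists B'.
    by move=> K; rewrite big_nat_recr//= /p c0 eqxx expr1n mulr1.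
  have y0 : y != 0 by rewrite gt_eqF//; lra.
  have ncc : nc (c n) = y by rewrite cE ncM u1 mulr1 nc_real ger0_norm//; lra.
  have dE : d n = y^-1%:C%C * u.
    rewrite /d ncc cE mulrA -rmorphM; congr (_%:C%C * _); field.
    exact: y0.
  have cn0 : c n != 0 by rewrite -nc_eq0 ncc.
  rewrite cE in hB' IH.
  have [B'' gB] := wle_lmulV rg u1 y1 hB'.
  split; first by apply: wle_lmul gB.
  rewrite dE big_nat_recr//= => K; rewrite -mulrA {2}/p (negbTE cn0) ncc.
  set P := \prod_(0 <= k < n) _ in IH *.
  have P0 : 0 < P.
    by apply: prodr_gt0 => k _; rewrite exprn_gt0// /p; case: ifPn => // ?; rewrite nc_gt0.
  rewrite mulrC -ler_pdivlMr//; apply: hsum_ray gB _ _ => // K'.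
  by rewrite ler_pdivlMr// mulrC.
have p1 n : 1 <= p n.
  rewrite /p; case: ifPn => // c0; have [u [y [u1 cE [y1|y0]]]] := hc n.
    by rewrite cE ncM u1 mulr1 nc_real ger0_norm; lra.
  by rewrite cE y0 mul0r eqxx in c0.
exists (B / nc (h 0%N 0%N) ^+ 2) => n.
have n0 : 0 < nc (h 0%N 0%N) ^+ 2 by rewrite exprn_gt0// nc_gt0.
have := (main n).2 1%N; rewrite /hsum big_nat1 (moved0 d hq).
rewrite -ler_pdivlMr// => H; apply: le_trans H.
(* The sum of the p_k - 1 is at most the product P of the p_k^2: as P >= 1, P (p^2 - 1) >= p^2 - 1
   >= p - 1. *)
elim: n => [|n IH]; first by rewrite !big_nil.
rewrite !big_nat_recr//=.
have -> : (if c n == 0 then 0 else nc (c n) - 1) = p n - 1.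
  by rewrite /p; case: ifP => // _; rewrite subrr.
set P := \prod_(0 <= k < n) _ in IH *.
have P1 : 1 <= P.
  rewrite /P; elim: (n) => [|k IHk]; first by rewrite big_nil.
  by rewrite big_nat_recr//=; apply: mulr_ege1 => //; apply: exprn_ege1.
have pn := p1 n; have pn2 : 1 <= p n ^+ 2 by rewrite exprn_ege1.
have : 0 <= (P - 1) * (p n ^+ 2 - 1) by rewrite mulr_ge0 ?subr_ge0.
have : 0 <= p n * (p n - 1) by rewrite mulr_ge0 ?subr_ge0 ?(le_trans ler01).
lra.
Qed.

End Nonvanishing.

(** * Area and complex multiplication *)

Section LinearChange.
Variable R : realType.
Local Notation C := (R[i] : numClosedFieldType).
Local Notation RR := (measurableTypeR R).
Local Notation mu := (@lebesgue_measure R).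
Local Notation area := (@area R).

Definition affR (l k : R) : RR -> RR := fun y => k + l * y.

Lemma measurable_affR l k : measurable_fun setT (affR l k).
Proof. by apply: measurable_funD => //; apply: measurable_funM. Qed.

(** |l| times the pushforward agrees with Lebesgue measure on the intervals ]a, b], hence
    everywhere. For l < 0 the preimages are closed on the other side, with the same length. *)
Lemma lebesgue_measure_aff (l k : R) (A : set RR) : l != 0 :> R -> measurable A ->
  mu (affR l k @^-1` A) = (`|l|^-1%:E * mu A)%E.
Proof.
move=> l0 mA.
(* This instance takes a measurability proof, so it cannot be inferred. *)
pose pf : {measure set RR -> \bar R} :=
  measure_function_pushforward__canonical__measure_function_Measure mu (@measurable_affR l k).
pose m' := mscale (NngNum (normr_ge0 l)) pf.
have l00 : 0 < `|l| by rewrite normr_gt0.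
have -> : mu A = m' A.
  apply: lebesgue_measure_unique => // X [[a b] _ <-] /=.
  rewrite /m' /mscale /= /pushforward.
  have [ab|ba] := ltP a b; last first.
    by rewrite set_itv_ge ?bnd_simp -?leNgt// preimage_set0 !measure0 mule0.
  rewrite lebesgue_measure_itv /= lte_fin ab.
  have [l1|l1] := ltP 0 l.
    have -> : affR l k @^-1` `]a, b]%classic = `](a - k) / l, (b - k) / l]%classic.
      apply/seteqP; split => y /=; rewrite !in_itv /= /affR ltr_pdivrMr// ler_pdivlMr// ltrBlDl lerBrDl;
        by rewrite mulrC.
    rewrite lebesgue_measure_itv /= lte_fin ltr_pM2r ?invr_gt0// ltrD2r ab.
    rewrite -!EFinB -EFinM; congr _%:E; rewrite gtr0_norm//.
    by field; rewrite gt_eqF.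
  have l2 : l < 0 by rewrite lt_neqAle l0.
  have -> : affR l k @^-1` `]a, b]%classic = `[(b - k) / l, (a - k) / l[%classic.
    apply/seteqP; split => y /=; rewrite !in_itv /= /affR ltr_ndivlMr// ler_ndivrMr// ltrBlDl lerBrDl;
        by rewrite mulrC andbC.
  rewrite lebesgue_measure_itv /= lte_fin ltr_nM2r ?invr_lt0// ltrD2r ab.
  rewrite -!EFinB -EFinM; congr _%:E; rewrite ltr0_norm//.
  by field; rewrite lt_eqF.
rewrite /m' /mscale /= /pushforward muleA -EFinM mulVf ?mul1e//.
by rewrite gt_eqF.
Qed.

(* Multiplication by a complex number with nonzero real part is a product of
   two shears (an LU decomposition), whose effect on area is read off sections. *)
Definition vshear (l k : R) : RR * RR -> RR * RR := fun p => (p.1, k * p.1 + l * p.2).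
Definition hshear (l k : R) : RR * RR -> RR * RR := fun p => (l * p.1 + k * p.2, p.2).

Lemma measurable_vshear l k : measurable_fun setT (vshear l k).
Proof.
apply/measurable_fun_pairP; split; first exact: measurable_fst.
by apply: measurable_funD; apply: measurable_funM.
Qed.

Lemma measurable_hshear l k : measurable_fun setT (hshear l k).
Proof.
apply/measurable_fun_pairP; split; last exact: measurable_snd.
by apply: measurable_funD; apply: measurable_funM.
Qed.

Lemma area_vshear (l k : R) (E : set (RR * RR)) : l != 0 -> measurable E ->
  area (vshear l k @^-1` E) = (`|l|^-1%:E * area E)%E.
Proof.
move=> l0 mE; rewrite /area /product_measure1 -ge0_integralZl//; last exact: measurable_fun_xsection.
apply: eq_integral => x _ /=; rewrite -(@lebesgue_measure_aff l (k * x))//; exact: measurable_xsection.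
Qed.

(** A horizontal shear acts on horizontal sections, while [area] integrates vertical ones. *)
Lemma area_swap (E : set (RR * RR)) : measurable E -> area E = (mu \x^ mu)%E E.
Proof.
by move=> mE; apply: product_measure_unique => // A B mA mB; exact: product_measure2E.
Qed.

Lemma area_hshear (l k : R) (E : set (RR * RR)) : l != 0 -> measurable E ->
  area (hshear l k @^-1` E) = (`|l|^-1%:E * area E)%E.
Proof.
move=> l0 mE; rewrite !area_swap//; last first.
  by rewrite -[X in measurable X]setTI; exact: measurable_hshear.
rewrite /product_measure2 -ge0_integralZl//; last by apply: measurable_fun_ysection; rewrite ?inE.
apply: eq_integral => x _ /=; rewrite -(@lebesgue_measure_aff l (k * x))//; last exact: measurable_ysection.
by congr (mu _); apply/seteqP; split => y; rewrite /ysection /affR /= !inE /= addrC.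
Qed.

Definition mulp (w : C) : RR * RR -> RR * RR := fun p =>
  (complex.Re w * p.1 - complex.Im w * p.2, complex.Im w * p.1 + complex.Re w * p.2).

Lemma measurable_mulp w : measurable_fun setT (mulp w).
Proof.
apply/measurable_fun_pairP; split; rewrite /mulp /=.
  by apply: measurable_funB; apply: measurable_funM.
by apply: measurable_funD; apply: measurable_funM.
Qed.

Lemma measurable_mulp_preimage w E : measurable E -> measurable (mulp w @^-1` E).
Proof. by move=> mE; rewrite -[X in measurable X]setTI; exact: measurable_mulp. Qed.

Lemma mulpM (w v : C) : mulp (w * v) = mulp w \o mulp v.
Proof.
case: w v => a b [c d]; apply/funext => -[x y]; rewrite /mulp /=; congr pair; ring.
Qed.

Lemma area_mulp_Re (w : C) (E : set (RR * RR)) : complex.Re w != 0 -> measurable E ->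
  area (mulp w @^-1` E) = ((sqrnorm w)^-1%:E * area E)%E.
Proof.
case: w => a b /= a0 mE.
have s0 : a ^+ 2 + b ^+ 2 != 0.
  by rewrite paddr_eq0 ?sqr_ge0// sqrf_eq0 (negbTE a0).
have -> : mulp (a +i* b)%C = vshear ((a ^+ 2 + b ^+ 2) / a) (b / a) \o hshear a (- b).
  apply/funext => -[x y]; rewrite /mulp /vshear /hshear /=; congr pair; first by ring.
  by field.
rewrite comp_preimage area_hshear//; last first.
  by rewrite -[X in measurable X]setTI; exact: measurable_vshear.
rewrite area_vshear//; last by rewrite mulf_neq0// invr_eq0.
rewrite muleA -EFinM /sqrnorm /=; congr (_%:E * _)%E.
rewrite normrM normfV invfM invrK mulrCA mulVf ?mulr1; last by rewrite normr_eq0.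
by rewrite ger0_norm// addr_ge0 ?sqr_ge0.
Qed.

Lemma area_mulp (w : C) (E : set (RR * RR)) : w != 0 -> measurable E ->
  area (mulp w @^-1` E) = ((sqrnorm w)^-1%:E * area E)%E.
Proof.
move=> w0 mE; have [Re0|] := eqVneq (complex.Re w) 0; last by move=> ?; exact: area_mulp_Re.
(* An imaginary w is (1 + i) (y + i y), a product of two numbers with nonzero real part. *)
pose y := complex.Im w / 2.
have y0 : y != 0.
  apply: contra w0 => /eqP y0; rewrite eq_complex Re0 eqxx /=; apply/eqP; move: y0; rewrite /y; lra.
have wE : w = (1 +i* 1)%C * (y +i* y)%C.
  by apply/eqP; rewrite eq_complex /= Re0 /y; apply/andP; split; apply/eqP; field.
rewrite wE mulpM comp_preimage area_mulp_Re//; last exact: measurable_mulp_preimage.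
rewrite area_mulp_Re//= ?oner_eq0// muleA -EFinM; congr (_%:E * _)%E.
by rewrite sqrnormM invfM mulrC.
Qed.

End LinearChange.

(** * Integrals over discs and the moments of |z|^2 *)

Section DiscIntegrals.
Variable R : realType.
Local Notation C := (R[i] : numClosedFieldType).
Local Notation RR := (measurableTypeR R).
Local Notation mu := (@lebesgue_measure R).
Local Notation area := (@area R).
Local Notation disc2 := (@disc2 R).

Definition cp (p : RR * RR) : C := (p.1 +i* p.2)%C.

Lemma cp_mulp w p : cp (mulp w p) = w * cp p.
Proof. by case: w p => a b [x y]; apply/eqP; rewrite eq_complex /=; apply/andP; split; apply/eqP => /=; ring. Qed.

Definition discr (rho : R) : set (RR * RR) := [set p | sqrnorm (cp p) < rho ^+ 2].

Lemma disc2E : disc2 = discr 1.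
Proof.
apply/seteqP; split => p /=; rewrite /disc2 /discr /= expr1n -sqr_nc.
  by move/discE => h; rewrite expr_lt1.
by move=> h; apply/discE; rewrite -(@expr_lt1 _ 2).
Qed.

(* Closed under sums, products and conjugation, which makes the integrability of
   polynomials in [z] and its conjugate automatic. *)
Definition ctame (F : RR * RR -> C) :=
  [/\ measurable_fun setT (fun p => complex.Re (F p)),
      measurable_fun setT (fun p => complex.Im (F p)) &
      exists K : R, forall p, disc2 p -> nc (F p) <= K].

Lemma ctame_cst (c : C) : ctame (fun=> c).
Proof. by split => //; exists (nc c). Qed.

Lemma ctame_cp : ctame cp.
Proof.
split; [exact: measurable_fst|exact: measurable_snd|].
by exists 1 => p; rewrite disc2E /discr /= expr1n -sqr_nc expr_lt1// => /ltW.
Qed.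

Lemma ctameD F G : ctame F -> ctame G -> ctame (fun p => F p + G p).
Proof.
move=> [F1 F2 [K FK]] [G1 G2 [L GL]]; split.
- by under eq_fun do rewrite raddfD; exact: measurable_funD.
- by under eq_fun do rewrite raddfD; exact: measurable_funD.
- exists (K + L) => p pd; rewrite (le_trans (ler_ncD _ _))// lerD//; [exact: FK|exact: GL].
Qed.

Lemma ReM (x y : C) : complex.Re (x * y) = complex.Re x * complex.Re y - complex.Im x * complex.Im y.
Proof. by case: x y => a b []. Qed.

Lemma ImM (x y : C) : complex.Im (x * y) = complex.Re x * complex.Im y + complex.Im x * complex.Re y.
Proof. by case: x y => a b []. Qed.

Lemma ctameM F G : ctame F -> ctame G -> ctame (fun p => F p * G p).
Proof.
move=> [F1 F2 [K FK]] [G1 G2 [L GL]]; split.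
- by under eq_fun do rewrite ReM; apply: measurable_funB; apply: measurable_funM.
- by under eq_fun do rewrite ImM; apply: measurable_funD; apply: measurable_funM.
- by exists (K * L) => p pd; rewrite ncM ler_pM//; [exact: FK|exact: GL].
Qed.

Lemma nc_conj (x : C) : nc x^*%C = nc x.
Proof. by case: x => a b; rewrite /nc /sqrnorm /= sqrrN. Qed.

Lemma ctame_conj F : ctame F -> ctame (fun p => (F p)^*%C).
Proof.
move=> [F1 F2 [K FK]]; split.
- by apply: eq_measurable_fun F1 => p _; case: (F p).
- apply: (@eq_measurable_fun _ _ _ _ _ (fun p => - complex.Im (F p))).
    by move=> p _; case: (F p).
  exact: measurable_funN.
- by exists K => p pd; rewrite nc_conj; exact: FK.
Qed.

Lemma ctameX F n : ctame F -> ctame (fun p => F p ^+ n).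
Proof.
move=> tF; elim: n => [|n IH]; first by under eq_fun do rewrite expr0; exact: ctame_cst.
by under eq_fun do rewrite exprS; exact: ctameM.
Qed.

Lemma ctame_sum (F : nat -> RR * RR -> C) n : (forall k, ctame (F k)) ->
  ctame (fun p => \sum_(0 <= k < n) F k p).
Proof.
move=> tF; elim: n => [|n IH].
  by under eq_fun do rewrite big_nil; exact: ctame_cst.
by under eq_fun do rewrite big_nat_recr//=; exact: ctameD.
Qed.

Definition pol (b : nat -> C) n p : C := \sum_(0 <= k < n) b k * cp p ^+ k.

Lemma ctame_pol b n : ctame (pol b n).
Proof.
apply: (ctame_sum (F := fun k p => b k * cp p ^+ k)) => k.
exact: ctameM (ctame_cst _) (ctameX _ ctame_cp).
Qed.

Lemma measurable_sqrnorm F : ctame F -> measurable_fun setT (fun p => sqrnorm (F p)).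
Proof. by move=> [F1 F2 _]; apply: measurable_funD; exact: measurable_funX. Qed.

Lemma measurable_discr rho : measurable (discr rho).
Proof.
have -> : discr rho = (fun p => sqrnorm (cp p)) @^-1` `]-oo, (rho ^+ 2)[%classic.
  by apply/seteqP; split => p; rewrite /discr /= in_itv.
by rewrite -[X in measurable X]setTI; apply: (measurable_sqrnorm ctame_cp).
Qed.
Hint Resolve measurable_discr : core.

Lemma measurable_disc2 : measurable disc2.
Proof. by rewrite disc2E. Qed.

Lemma discr_sub rho : 0 <= rho <= 1 -> discr rho `<=` disc2.
Proof.
move=> /andP[r0 r1] p; rewrite disc2E /discr /= => h; apply: lt_le_trans h _.
by rewrite lerXn2r ?nnegrE.
Qed.

Lemma area_disc2_ltoo : (area disc2 < +oo)%E.
Proof.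
pose I : set RR := `[-1, 1]%classic.
have mI : measurable I by exact: measurable_itv.
apply: (@le_lt_trans _ _ (area (I `*` I))).
  apply: le_measure; rewrite ?inE; [exact: measurable_disc2|exact: measurableX|].
  move=> [x y]; rewrite disc2E /discr /cp /sqrnorm /= expr1n => h.
  by rewrite /I /= !in_itv /=; split; apply/andP; split; nra.
have -> : area (I `*` I) = (mu I * mu I)%E by exact: product_measure1E.
rewrite /I lebesgue_measure_itv /=.
by case: ifP => _; rewrite -?EFinB -?EFinM ?mule0 ltry.
Qed.

Lemma area_disc2_gt0 : (0 < area disc2)%E.
Proof.
pose I : set RR := `]0, 2^-1[%classic.
have mI : measurable I by exact: measurable_itv.
apply: (@lt_le_trans _ _ (area (I `*` I))).
  have -> : area (I `*` I) = (mu I * mu I)%E by exact: product_measure1E.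
  rewrite /I lebesgue_measure_itv /= lte_fin invr_gt0 ltr0n.
  by rewrite -EFinB -EFinM lte_fin subr0 mulr_gt0.
apply: le_measure; rewrite ?inE; [exact: measurableX|exact: measurable_disc2|].
move=> [x y] [] /=; rewrite /I /= !in_itv /= => /andP[x0 x1] /andP[y0 y1].
by rewrite disc2E /discr /cp /sqrnorm /= expr1n; nra.
Qed.

Lemma tame_integrable (f : RR * RR -> R) (K : R) E : measurable_fun setT f ->
  (forall p, disc2 p -> `|f p| <= K) -> measurable E -> E `<=` disc2 ->
  area.-integrable E (EFin \o f).
Proof.
move=> mf fK mE ED; apply: measurable_bounded_integrable => //.
- apply: le_lt_trans area_disc2_ltoo; apply: le_measure; rewrite ?inE//.
  exact: measurable_disc2.
- exact: measurable_funTS.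
- exists K; split; first exact: num_real.
  by move=> M KM p /= /ED /fK h; rewrite (le_trans h)// ltW.
Qed.

Lemma Re_integrable F E : ctame F -> measurable E -> E `<=` disc2 ->
  area.-integrable E (EFin \o (fun p => complex.Re (F p))).
Proof.
move=> [F1 F2 [K FK]]; apply: (@tame_integrable _ K) => // p pd.
by rewrite (le_trans (normRe_le _))// FK.
Qed.

Lemma sqrnorm_integrable F E : ctame F -> measurable E -> E `<=` disc2 ->
  area.-integrable E (EFin \o (fun p => sqrnorm (F p))).
Proof.
move=> tF; have [F1 F2 [K FK]] := tF.
apply: (@tame_integrable _ (K ^+ 2)); first exact: measurable_sqrnorm.
move=> p pd; rewrite ger0_norm ?sqrnorm_ge0// -sqr_nc lerXn2r ?nnegrE ?FK//.
by rewrite (le_trans _ (FK _ pd)).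
Qed.

Lemma ge0_integral_mulp (w : C) (f : RR * RR -> \bar R) E : w != 0 -> measurable E ->
  measurable_fun setT f -> (forall p, 0 <= f p)%E ->
  (\int[area]_(p in mulp w @^-1` E) f (mulp w p) =
   (sqrnorm w)^-1%:E * \int[area]_(p in E) f p)%E.
Proof.
move=> w0 mE mf f0.
have s0 : 0 <= (sqrnorm w)^-1 by rewrite invr_ge0 sqrnorm_ge0.
rewrite -(ge0_integral_mscale area mE (NngNum s0))//; last exact: measurable_funTS.
rewrite -(ge0_integral_pushforward (measurable_mulp w))//; last exact: measurable_funTS.
pose pf : {measure set (RR * RR) -> \bar R} :=
  measure_function_pushforward__canonical__measure_function_Measure area (@measurable_mulp R w).
apply: (@eq_measure_integral _ _ _ _ (mscale (NngNum s0) area) pf) => A mA _.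
exact: area_mulp.
Qed.

Lemma integral_rot (w : C) (f : RR * RR -> R) E : sqrnorm w = 1 -> measurable E ->
  measurable_fun setT f ->
  area.-integrable (mulp w @^-1` E) (EFin \o (f \o mulp w)) ->
  \int[area]_(p in mulp w @^-1` E) f (mulp w p) = \int[area]_(p in E) f p.
Proof.
move=> w1 mE mf intf; congr fine.
have w0 : w != 0 by rewrite -nc_eq0 -sqrf_eq0 sqr_nc w1 oner_eq0.
have mf' : measurable_fun setT (EFin \o f) by exact/measurable_EFinP.
apply: etrans (esym (integral_pushforward (measurable_mulp w) mf' intf mE)) _.
pose pf : {measure set (RR * RR) -> \bar R} :=
  measure_function_pushforward__canonical__measure_function_Measure area (@measurable_mulp R w).
apply: (@eq_measure_integral _ _ _ _ area pf) => A mA _.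
by rewrite [LHS]area_mulp// w1 invr1 mul1e.
Qed.

Lemma rot_discr (w : C) rho : sqrnorm w = 1 -> mulp w @^-1` discr rho = discr rho.
Proof.
by move=> w1; apply/seteqP; split => p; rewrite /discr /= cp_mulp sqrnormM w1 mul1r.
Qed.

Lemma scale_discr (rho : R) : 0 < rho -> mulp rho%:C%C @^-1` discr rho = disc2.
Proof.
move=> r0; rewrite disc2E; apply/seteqP; split => p; rewrite /discr /= cp_mulp sqrnormM;
  by rewrite -(sqr_nc rho%:C%C) nc_real real_normK ?num_real// expr1n gtr_pMr ?exprn_gt0.
Qed.

Definition moment n : R := \int[area]_(p in disc2) sqrnorm (cp p ^+ n).

Lemma moment_ge0 n : 0 <= moment n.
Proof. by apply: Rintegral_ge0 => p _; exact: sqrnorm_ge0. Qed.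

Lemma sqrnormX (x : C) n : sqrnorm (x ^+ n) = sqrnorm x ^+ n.
Proof. by rewrite -!sqr_nc ncX exprAC. Qed.

Lemma Rintegral_scale (F : RR * RR -> C) (rho : R) : 0 < rho -> ctame F ->
  \int[area]_(p in discr rho) sqrnorm (F p) =
  rho ^+ 2 * \int[area]_(p in disc2) sqrnorm (F (mulp rho%:C%C p)).
Proof.
move=> r0 tF.
have w0 : (rho%:C%C : C) != 0 by rewrite -nc_eq0 nc_real normr_eq0 gt_eqF.
have mf : measurable_fun setT (fun p => (sqrnorm (F p))%:E).
  by apply/measurable_EFinP; exact: measurable_sqrnorm.
have f0 p : (0 <= (sqrnorm (F p))%:E)%E by rewrite lee_fin sqrnorm_ge0.
have := ge0_integral_mulp w0 (measurable_discr rho) mf f0.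
rewrite scale_discr// => H; rewrite /Rintegral H.
rewrite -(sqr_nc rho%:C%C) nc_real real_normK ?num_real//.
set I := (\int[area]_(p in discr rho) _)%E.
(* If the integral is infinite, [fine] makes both sides 0. *)
have [->|] := eqVneq I +oo%E.
  by rewrite gt0_muley ?lte_fin ?invr_gt0 ?exprn_gt0//= mulr0.
have I0 : (0 <= I)%E by apply: integral_ge0 => p _.
move=> Ioo; have If : I \is a fin_num by rewrite ge0_fin_numE// lt_neqAle Ioo leey.
rewrite -(fineK If) -EFinM /= mulVKf//.
by rewrite expf_neq0// gt_eqF.
Qed.

Lemma moment_scale n (rho : R) : 0 < rho ->
  \int[area]_(p in discr rho) sqrnorm (cp p ^+ n) = rho ^+ 2 * (rho ^+ 2) ^+ n * moment n.
Proof.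
move=> r0; rewrite (Rintegral_scale r0 (ctameX n ctame_cp)) -mulrA; congr (_ * _).
under eq_Rintegral do rewrite cp_mulp exprMn sqrnormM.
rewrite RintegralZl//; last 2 first.
- exact: measurable_disc2.
- exact: (sqrnorm_integrable (ctameX n ctame_cp) measurable_disc2).
by rewrite sqrnormX -(sqr_nc rho%:C%C) nc_real real_normK ?num_real.
Qed.

Lemma moment0 : moment 0 = fine (area disc2).
Proof.
rewrite /moment; under eq_Rintegral do rewrite expr0 -sqr_nc nc1 expr1n.
by rewrite Rintegral_cst ?mul1r//; exact: measurable_disc2.
Qed.

(* Bounds [|z|^2n] by its extreme values on the annulus [q <= |z|^2 < 1]. *)
Lemma moment_annulus n (q : R) : 0 < q < 1 ->
  q ^+ n * (moment 0 * (1 - q)) <= moment n * (1 - q ^+ n.+1) <= moment 0 * (1 - q).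
Proof.
move=> /andP[q0 q1]; pose rho := Num.sqrt q.
have r0 : 0 < rho by rewrite sqrtr_gt0.
have r2 : rho ^+ 2 = q by rewrite sqr_sqrtr// ltW.
have r1 : rho <= 1 by rewrite -sqrtr1 ler_wsqrtr// ltW.
have Dr : discr rho `<=` disc2 by apply: discr_sub; rewrite ltW.
pose An := disc2 `\` discr rho.
have mAn : measurable An by apply: measurableD => //; exact: measurable_disc2.
have AnD : An `<=` disc2 by apply: subDsetl.
have int m E : measurable E -> E `<=` disc2 ->
    area.-integrable E (EFin \o (fun p => sqrnorm (cp p ^+ m))).
  exact: (sqrnorm_integrable (ctameX m ctame_cp)).
have split_ m : \int[area]_(p in An) sqrnorm (cp p ^+ m) = moment m * (1 - q ^+ m.+1).
  have : moment m = \int[area]_(p in discr rho) sqrnorm (cp p ^+ m) + \int[area]_(p in An) sqrnorm (cp p ^+ m).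
    rewrite /moment -(setDUK Dr) Rintegral_setU// ?setDUK//; last by rewrite disj_set2E setDIK.
    by apply: int => //; exact: measurable_disc2.
  rewrite moment_scale// r2 -exprS => H; rewrite mulrBr mulr1 {1}H; ring.
have [i0 in_] := (int 0%N An mAn AnD, int n An mAn AnD).
have s0 := split_ 0%N; rewrite expr1 in s0.
rewrite -s0 -split_; apply/andP; split.
  rewrite -RintegralZl//; apply: le_Rintegral => //.
    exact: (integrableZl mAn (q ^+ n) i0).
  move=> p [_ /negP]; rewrite -leNgt r2 => h.
  rewrite !sqrnormX expr0 mulr1; apply: lerXn2r; rewrite ?nnegrE ?(ltW q0)//.
  by rewrite sqrnorm_ge0.
apply: le_Rintegral => // p /AnD; rewrite disc2E /discr /= expr1n => h.
by rewrite !sqrnormX expr0 exprn_ile1// ?sqrnorm_ge0// ltW.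
Qed.

(** Lets q tend to 1, through Bernoulli's inequality for q = 1 - d with d (n x + 1) <= e. *)
Lemma expr_lim_le (x y : R) n : 0 <= x -> (forall q, 0 < q < 1 -> q ^+ n * x <= y) -> x <= y.
Proof.
move=> x0 H; apply/ler_addgt0Pr => e e0.
have bern (d : R) : 0 < d < 1 -> 1 - n%:R * d <= (1 - d) ^+ n.
  move=> /andP[d0 d1]; elim: n {H} => [|m IH]; first by rewrite mul0r subr0.
  rewrite exprS; apply: le_trans (ler_wpM2l _ IH); last by lra.
  by rewrite -natr1; have := ler0n R m; nra.
pose d := Num.min (1 / 2) (e / (n%:R * x + 1)).
have nx : 0 <= n%:R * x by rewrite mulr_ge0.
have d0 : 0 < d by rewrite lt_min; apply/andP; split; [lra|rewrite divr_gt0//; lra].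
have d1 : d < 1 by apply: le_lt_trans (_ : 1 / 2 < 1); [rewrite ge_min lexx|lra].
have d2 : d * (n%:R * x + 1) <= e.
  by rewrite -ler_pdivlMr; [rewrite ge_min lexx orbT|lra].
have := H (1 - d) ltac:(lra).
have := ler_wpM2r x0 (bern d ltac:(lra)); nra.
Qed.

(** Divided by 1 - q, the annulus estimate reads q^n m_0 <= m_n (1 + q + ... + q^n) <= m_0; q tends
    to 1. This replaces polar coordinates. *)
Lemma momentE n : moment n = fine (area disc2) / n.+1%:R.
Proof.
apply: (@mulIf _ n.+1%:R); rewrite ?pnatr_eq0// divfK ?pnatr_eq0// -moment0.
have geo (q : R) : 1 - q ^+ n.+1 = (1 - q) * \sum_(0 <= k < n.+1) q ^+ k.
  by rewrite big_mkord -[in LHS](opprB _ 1) subrX1 -mulNr opprB.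
have m0 := moment_ge0.
have key (q : R) : 0 < q < 1 -> q ^+ n * moment 0 <= moment n * n.+1%:R /\
   q ^+ n * (moment n * n.+1%:R) <= moment 0.
  move=> q01; have /andP[q0 q1] := q01.
  have /andP[] := moment_annulus n q01; rewrite geo.
  rewrite [moment n * _]mulrCA [moment 0 * _]mulrC [q ^+ n * _]mulrCA !ler_pM2l ?subr_gt0//.
  set S := \sum_(_ <= _ < _) _ => h1 h2; split.
    apply: le_trans h1 _; rewrite ler_wpM2l// -[n.+1 in leRHS]subn0 -sumr_const_nat.
    by apply: ler_sum => k _; rewrite exprn_ile1// ltW.
  apply: le_trans h2; rewrite mulrCA ler_wpM2l// mulr_natr -[n.+1 in leLHS]subn0 -sumr_const_nat.
  rewrite /S big_nat_cond [leRHS]big_nat_cond; apply: ler_sum => k /andP[/andP[_ kn] _].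
  by rewrite ler_wiXn2l// ltW.
apply/eqP; rewrite eq_le; apply/andP; split.
  by apply: (@expr_lim_le _ _ n); [rewrite mulr_ge0|move=> q /key[]].
by apply: (@expr_lim_le _ _ n) => // q /key[].
Qed.

End DiscIntegrals.

(** * Parseval's formula *)

Section Parseval.
Variable R : realType.
Local Notation C := (R[i] : numClosedFieldType).
Local Notation RR := (measurableTypeR R).
Local Notation area := (@area R).
Local Notation disc2 := (@disc2 R).
Local Notation cp := (@cp R).
Local Notation moment := (@moment R).
Implicit Types (b : nat -> C) (F : RR * RR -> C).

Lemma conjc_mul_sqrnorm (x : C) : x * x^*%C = (sqrnorm x)%:C%C.
Proof. by rewrite -sqr_normc normcE -rmorphXn /= sqr_nc. Qed.

Lemma unit_root_m1 n : (0 < n)%N -> exists2 w : C, sqrnorm w = 1 & w ^+ n = -1.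
Proof.
move=> n0; have wn := rootCK n0 (-1 : C); exists (n.-root (-1 : C)) => //.
have : nc (n.-root (-1 : C)) ^+ n == 1 by rewrite -ncX wn ncN nc1.
by rewrite pexpr_eq1// => /eqP h; rewrite -sqr_nc h expr1n.
Qed.

(* A rotation [w] with [w ^+ (n - j) = -1] changes the sign of the integrand. *)
Lemma orthogonal_monomials (c : C) j n : (j < n)%N ->
  \int[area]_(p in disc2) complex.Re (c * cp p ^+ j * (cp p ^+ n)^*%C) = 0.
Proof.
move=> jn; have nj : (0 < n - j)%N by rewrite subn_gt0.
have [w w1 wn] := unit_root_m1 nj.
pose F p := c * cp p ^+ j * (cp p ^+ n)^*%C.
have tF : ctame F.
  apply: ctameM; first exact: ctameM (ctame_cst _) (ctameX _ (ctame_cp _)).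
  exact: ctame_conj (ctameX _ (ctame_cp _)).
have FN p : F (mulp w p) = - F p.
  rewrite /F cp_mulp !exprMn rmorphM /=.
  have e : w ^+ j * (w ^+ n)^*%C = -1.
    rewrite -(subnKC (ltnW jn)) exprD wn mulrN1 rmorphN /= mulrN.
    by rewrite conjc_mul_sqrnorm sqrnormX w1 expr1n.
  have -> : c * (w ^+ j * cp p ^+ j) * ((w ^+ n)^*%C * (cp p ^+ n)^*%C) =
     (w ^+ j * (w ^+ n)^*%C) * (c * cp p ^+ j * (cp p ^+ n)^*%C) by ring.
  by rewrite e mulN1r.
have mD := @measurable_disc2 R.
have iF : area.-integrable disc2 (EFin \o (fun p => complex.Re (F p))).
  exact: Re_integrable.
have H : \int[area]_(p in disc2) complex.Re (F p) = \int[area]_(p in disc2) (-1 * complex.Re (F p)).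
  have D1 : mulp w @^-1` disc2 = disc2 by rewrite disc2E rot_discr.
  have E : (fun p => complex.Re (F (mulp w p))) = (fun p => -1 * complex.Re (F p)).
    by apply/funext => p; rewrite FN raddfN mulN1r.
  rewrite -E -{2}D1; apply/esym; apply: (integral_rot w1 mD); first by case: tF.
  rewrite D1; have := integrableZl mD (-1) iF; congr (_.-integrable _ _).
  by apply/funext => p /=; rewrite FN raddfN -EFinM mulN1r.
move: H; rewrite RintegralZl//; lra.
Qed.

Lemma orthogonal_pol b (c : C) m n : (m <= n)%N ->
  \int[area]_(p in disc2) complex.Re (pol b m p * (c * cp p ^+ n)^*%C) = 0.
Proof.
have mD := @measurable_disc2 R.
elim: m => [|m IH] mn.
  under eq_Rintegral do rewrite /pol big_nil mul0r /=.
  by rewrite Rintegral_cst// mul0r.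
have E p : complex.Re (pol b m.+1 p * (c * cp p ^+ n)^*%C) =
    complex.Re (pol b m p * (c * cp p ^+ n)^*%C) +
    complex.Re (b m * c^*%C * cp p ^+ m * (cp p ^+ n)^*%C).
  rewrite -raddfD /=; congr (complex.Re _).
  by rewrite /pol big_nat_recr//= rmorphM /=; ring.
have tc : ctame (fun p => (c * cp p ^+ n)^*%C).
  exact/ctame_conj/(ctameM (ctame_cst _) (ctameX _ (ctame_cp _))).
under eq_Rintegral do rewrite E.
rewrite RintegralD// ?IH ?(ltnW mn)// ?orthogonal_monomials ?addr0//.
- exact: (Re_integrable (ctameM (ctame_pol b m) tc)).
- apply: Re_integrable => //; apply: ctameM; last exact: ctame_conj (ctameX _ (ctame_cp _)).
  exact: ctameM (ctame_cst _) (ctameX _ (ctame_cp _)).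
Qed.

Lemma sqrnormD (x y : C) : sqrnorm (x + y) = sqrnorm x + sqrnorm y + 2 * complex.Re (x * y^*%C).
Proof. by case: x y => a b [c d]; rewrite /sqrnorm /=; ring. Qed.

Lemma parseval_pol b n :
  \int[area]_(p in disc2) sqrnorm (pol b n p) =
  \sum_(0 <= k < n) nc (b k) ^+ 2 * moment k.
Proof.
have mD := @measurable_disc2 R.
elim: n => [|n IH].
  rewrite big_nil; under eq_Rintegral do rewrite /pol big_nil -sqr_nc nc0 expr0n.
  by rewrite Rintegral_cst// mul0r.
have tc : ctame (fun p => b n * cp p ^+ n).
  exact: (ctameM (ctame_cst _) (ctameX _ (ctame_cp _))).
have E p : sqrnorm (pol b n.+1 p) = (sqrnorm (pol b n p) + nc (b n) ^+ 2 * sqrnorm (cp p ^+ n)) +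
    2 * complex.Re (pol b n p * (b n * cp p ^+ n)^*%C).
  by rewrite {1}/pol big_nat_recr//= sqrnormD sqrnormM sqr_nc.
have i1 : area.-integrable disc2 (EFin \o (fun p => sqrnorm (pol b n p))).
  exact: sqrnorm_integrable (ctame_pol _ _) _ _.
have i2 : area.-integrable disc2 (EFin \o (fun p => sqrnorm (cp p ^+ n))).
  exact: sqrnorm_integrable (ctameX _ (ctame_cp _)) _ _.
have i3 : area.-integrable disc2 (EFin \o (fun p => complex.Re (pol b n p * (b n * cp p ^+ n)^*%C))).
  exact: Re_integrable (ctameM (ctame_pol _ _) (ctame_conj tc)) _ _.
under eq_Rintegral do rewrite E.
have i4 := integrableZl mD (nc (b n) ^+ 2) i2.
have i5 := integrableZl mD 2 i3.
rewrite RintegralD//; last exact: (integrableD mD i1 i4).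
rewrite RintegralD// !RintegralZl// orthogonal_pol// mulr0 addr0 IH.
by rewrite [in RHS]big_nat_recr.
Qed.

Lemma parseval_pol_discr b n (rho : R) : 0 < rho ->
  \int[area]_(p in discr rho) sqrnorm (pol b n p) =
  \sum_(0 <= k < n) nc (b k) ^+ 2 * moment k * (rho ^+ 2) ^+ k.+1.
Proof.
move=> r0; rewrite (Rintegral_scale r0 (ctame_pol b n)).
have E p : pol b n (mulp rho%:C%C p) = pol (fun k => b k * rho%:C%C ^+ k) n p.
  by apply: eq_bigr => k _; rewrite cp_mulp exprMn mulrA.
under eq_Rintegral do rewrite E.
rewrite parseval_pol mulr_sumr; apply: eq_bigr => k _.
rewrite ncM exprMn ncX nc_real (ger0_norm (ltW r0)) [(rho ^+ k) ^+ 2]exprAC.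
by rewrite [(rho ^+ 2) ^+ k.+1]exprS; set x := (rho ^+ 2) ^+ k; ring.
Qed.

(* The integral of [|b_k z^k|^2] over the disc. *)
Definition cterm b k : R := fine (area disc2) * (nc (b k) ^+ 2 / k.+1%:R).

Lemma cterm_ge0 b k : 0 <= cterm b k.
Proof. by rewrite mulr_ge0 ?fine_ge0 ?divr_ge0 ?sqr_ge0// ltW// area_disc2_gt0. Qed.

Lemma cterm_moment b k : nc (b k) ^+ 2 * moment k = cterm b k.
Proof. by rewrite momentE /cterm; ring. Qed.

Lemma cvg_sqrnorm_pol b G p : has_series b G -> disc2 p ->
  sqrnorm (pol b n p) @[n --> \oo] --> sqrnorm (G (cp p)).
Proof.
move=> bG pd.
have H := cvg_nc (bG (cp p) pd).
under eq_fun do rewrite -sqr_nc expr2; rewrite -sqr_nc expr2.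
exact: (cvgM H H).
Qed.

Lemma measurable_sqrnorm_series b G : has_series b G ->
  measurable_fun disc2 (fun p => (sqrnorm (G (cp p)))%:E).
Proof.
move=> bG; apply/measurable_EFinP.
apply: (@measurable_fun_cvg _ _ _ _ (fun n p => sqrnorm (pol b n p))).
  move=> n; apply: measurable_funTS; exact: measurable_sqrnorm (ctame_pol _ _).
by move=> p pd; exact: cvg_sqrnorm_pol.
Qed.

(** Either side may be infinite, and the partial sums need not be dominated on the whole disc.
    Fatou's lemma gives this half; the other uses dominated convergence on smaller discs, where the
    partial sums are uniformly bounded. *)
Lemma parseval_le b G : has_series b G ->
  (\int[area]_(p in disc2) (sqrnorm (G (cp p)))%:E <= \sum_(0 <= k <oo) (cterm b k)%:E)%E.
Proof.
move=> bG; have mD := @measurable_disc2 R.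
pose f n p := (sqrnorm (pol b n p))%:E.
have mf n : measurable_fun disc2 (f n).
  apply/measurable_EFinP; apply: measurable_funTS; exact: measurable_sqrnorm (ctame_pol _ _).
have f0 n p : disc2 p -> (0 <= f n p)%E by move=> _; rewrite lee_fin sqrnorm_ge0.
have -> : (\int[area]_(p in disc2) (sqrnorm (G (cp p)))%:E =
    \int[area]_(p in disc2) limn_einf (f^~ p))%E.
  apply: eq_integral => p; rewrite inE => pd; apply/esym.
  have h : f n p @[n --> \oo] --> (sqrnorm (G (cp p)))%:E.
    by apply/fine_cvgP; split; [exact: nearW|exact: cvg_sqrnorm_pol bG pd].
  by have [] := cvg_limn_einf_sup h.
apply: le_trans (@fatou _ _ _ area disc2 mD f mf f0) _.
have E n : (\int[area]_(p in disc2) f n p = \sum_(0 <= k < n) (cterm b k)%:E)%E.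
  have i := sqrnorm_integrable (ctame_pol b n) mD (@subset_refl _ _).
  rewrite -[LHS]fineK; last exact: (integrable_fin_num mD i).
  rewrite -[fine _]/(\int[area]_(p in disc2) sqrnorm (pol b n p)) parseval_pol.
  rewrite sumEFin; congr (_%:E); apply: eq_bigr => k _; exact: cterm_moment.
under eq_fun do rewrite E.
rewrite is_cvg_limn_einfE//; apply: is_cvg_nneseries => k _ _.
by rewrite lee_fin cterm_ge0.
Qed.

Lemma parseval_ge_discr b G n (rho : R) : has_series b G -> 0 < rho < 1 ->
  ((\sum_(0 <= k < n) cterm b k * (rho ^+ 2) ^+ k.+1)%:E <=
   \int[area]_(p in disc2) (sqrnorm (G (cp p)))%:E)%E.
Proof.
move=> bG /andP[r0 r1]; have mD := @measurable_disc2 R.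
have mr := @measurable_discr R rho.
have Dr : discr rho `<=` disc2 by apply: discr_sub; rewrite !ltW.
have mG := measurable_sqrnorm_series bG.
apply: (@le_trans _ _ (\int[area]_(p in discr rho) (sqrnorm (G (cp p)))%:E)%E); last first.
  by apply: ge0_subset_integral => // p _; rewrite lee_fin sqrnorm_ge0.
have rho01 : 0 <= rho < 1 by rewrite (ltW r0).
have [S hS] := subexp_sum (has_series_subexp bG) rho01.
pose f m p := (sqrnorm (pol b m p))%:E.
have mf m : measurable_fun (discr rho) (f m).
  apply/measurable_EFinP; apply: measurable_funTS; exact: measurable_sqrnorm (ctame_pol _ _).
have mGr : measurable_fun (discr rho) (fun p => (sqrnorm (G (cp p)))%:E).
  exact: measurable_funS mG.
have [] := dominated_convergence (mu := area) mr mf mGr (g := fun=> (S ^+ 2)%:E).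
- apply: aeW => p pd; apply/fine_cvgP; split; [exact: nearW|].
  by apply: cvg_sqrnorm_pol bG _; exact: Dr.
- apply: (@tame_integrable _ (fun=> S ^+ 2) (`|S ^+ 2|)) => //.
- apply: aeW => p m pd /=; rewrite lee_fin ger0_norm ?sqrnorm_ge0// -sqr_nc.
  have pr : nc (cp p) <= rho.
    move: pd; rewrite /discr /= -sqr_nc => /ltW; rewrite ler_pXn2r ?nnegrE// ltW//.
  have h : nc (pol b m p) <= S.
    apply: le_trans (hS m); apply: (le_trans (ler_nc_sum _ _ _)).
    apply: ler_sum => k _; rewrite ncM ncX ler_wpM2l// lerXn2r ?nnegrE// ltW//.
  by rewrite lerXn2r ?nnegrE// (le_trans _ h).
move=> _ _ cv; rewrite -(cvg_lim _ cv)//; apply: lime_ge; first by apply/cvg_ex; eexists; exact: cv.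
exists n => // m /= nm.
have i := sqrnorm_integrable (ctame_pol b m) mr Dr.
rewrite -[leRHS]fineK; last exact: (integrable_fin_num mr i).
rewrite -[fine _]/(\int[area]_(p in discr rho) sqrnorm (pol b m p)) parseval_pol_discr// lee_fin.
rewrite [leRHS](@big_cat_nat _ _ _ n)//=.
under eq_bigr do rewrite -cterm_moment.
rewrite lerDl sumr_ge0// => k _.
by rewrite cterm_moment mulr_ge0 ?cterm_ge0// exprn_ge0// sqr_ge0.
Qed.

Lemma parseval_series b G : has_series b G ->
  (\int[area]_(p in disc2) (sqrnorm (G (cp p)))%:E = \sum_(0 <= k <oo) (cterm b k)%:E)%E.
Proof.
move=> bG; apply/eqP; rewrite eq_le parseval_le//=.
apply: lime_le; first by apply: is_cvg_nneseries => k _ _; rewrite lee_fin cterm_ge0.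
apply: nearW => n; rewrite sumEFin.
set Y := (\int[area]_(p in disc2) _)%E.
have Y0 : (0 <= Y)%E by apply: integral_ge0 => p _; rewrite lee_fin sqrnorm_ge0.
have [->|Yoo] := eqVneq Y +oo%E; first exact: leey.
have Yf : Y \is a fin_num by rewrite ge0_fin_numE// lt_neqAle Yoo leey.
rewrite -(fineK Yf) lee_fin; apply: (@expr_lim_le _ _ _ n).
  by apply: sumr_ge0 => k _; exact: cterm_ge0.
move=> q /andP[q0 q1].
pose rho := Num.sqrt q.
have r2 : rho ^+ 2 = q by rewrite sqr_sqrtr// ltW.
have rho01 : 0 < rho < 1 by rewrite sqrtr_gt0 q0 -[ltRHS]sqrtr1 ltr_sqrt.
have := parseval_ge_discr n bG rho01; rewrite -/Y -(fineK Yf) lee_fin r2; apply: le_trans.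
rewrite mulr_sumr big_nat_cond [leRHS]big_nat_cond; apply: ler_sum => k /andP[/andP[_ kn] _].
by rewrite mulrC ler_wpM2l ?cterm_ge0// ler_wiXn2l// ltW.
Qed.

Implicit Types (a : nat -> C) (f : C -> C).

Lemma dirichlet_integral_series a f : has_series a f ->
  (dirichlet_integral f = \sum_(0 <= k <oo) (k%:R * nc (a k) ^+ 2)%:E)%E.
Proof.
move=> af; have dG := has_series_derive1 af.
rewrite /dirichlet_integral; have := parseval_series dG; rewrite /cp /= => ->.
have A0 : 0 < fine (area disc2).
  by rewrite fine_gt0// area_disc2_gt0 area_disc2_ltoo.
rewrite -nneseriesZl; last by move=> k _; rewrite lee_fin cterm_ge0.
have E k : ((fine (area disc2))^-1%:E * (cterm (dser a) k)%:E = (k.+1%:R * nc (a k.+1) ^+ 2)%:E)%E.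
  rewrite -EFinM /cterm mulKf ?gt_eqF// /dser ncM nc_nat exprMn; congr (_%:E).
  by rewrite mulrAC expr2 mulfK ?pnatr_eq0.
under eq_eseriesr do rewrite E.
(* The term of index 0 vanishes, so the series indexed by k + 1 has the same sum. *)
pose u k : \bar R := (k%:R * nc (a k) ^+ 2)%:E.
have u0 k : (0 <= u k)%E by rewrite lee_fin mulr_ge0 ?sqr_ge0.
have /cvg_ex[l /= ul] := @is_cvg_nneseries _ u xpredT 0 (fun k _ _ => u0 k).
transitivity l; last by apply/esym/cvg_lim.
apply: cvg_lim => //; move: ul; rewrite -cvg_shiftS.
under eq_fun do rewrite big_nat_recl//= {1}/u mul0r add0e.
by [].
Qed.

Lemma hardy_sqnorm_series a f : has_series a f ->
  (hardy_sqnorm f = \sum_(0 <= k <oo) (nc (a k) ^+ 2)%:E)%E.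
Proof.
move=> af; apply: eq_eseriesr => k _.
by rewrite (has_series_taylor k af) sqr_nc.
Qed.

Lemma dirichlet_normE a f : has_series a f ->
  (dirichlet_integral f + hardy_sqnorm f =
   \sum_(0 <= k <oo) (k.+1%:R * nc (a k) ^+ 2)%:E)%E.
Proof.
move=> af; rewrite (dirichlet_integral_series af) (hardy_sqnorm_series af).
rewrite -nneseriesD; last 2 first.
- by move=> k _ _; rewrite lee_fin mulr_ge0 ?sqr_ge0.
- by move=> k _ _; rewrite lee_fin sqr_ge0.
by apply: eq_eseriesr => k _; rewrite -EFinD -natr1 mulrDl mul1r.
Qed.

Lemma dirichlet_norm_wle a f B : has_series a f ->
  (dirichlet_integral f + hardy_sqnorm f <= B%:E)%E <-> wle a B.
Proof.
move=> af; rewrite (dirichlet_normE af).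
have u0 k : (0 <= (k.+1%:R * nc (a k) ^+ 2)%:E)%E by rewrite lee_fin mulr_ge0 ?sqr_ge0.
split=> [h K|aB].
  by rewrite -lee_fin /wsum -sumEFin (le_trans _ h)// nneseries_lim_ge.
apply: lime_le; first exact: is_cvg_nneseries.
by apply: nearW => n; rewrite sumEFin lee_fin; exact: aB.
Qed.

(** Membership bounds only the sum of k |a_k|^2; k + 1 <= 2 k for k >= 1 recovers the full norm,
    with a_0 treated apart. *)
Lemma dirichlet_space_wle a f : has_series a f ->
  dirichlet_space f <-> exists B, wle a B.
Proof.
move=> af; split=> [[_]|[B aB]].
  rewrite (dirichlet_integral_series af) => h.
  set X := (\sum_(0 <= k <oo) _)%E in h.
  have u0 k : (0 <= (k%:R * nc (a k) ^+ 2)%:E)%E by rewrite lee_fin mulr_ge0 ?sqr_ge0.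
  have X0 : (0 <= X)%E by apply: nneseries_ge0.
  have Xf : X \is a fin_num by rewrite ge0_fin_numE.
  have hX n : \sum_(0 <= k < n) k%:R * nc (a k) ^+ 2 <= fine X.
    by rewrite -lee_fin fineK// -sumEFin nneseries_lim_ge.
  have X1 : 0 <= fine X by rewrite fine_ge0.
  exists (2 * fine X + nc (a 0%N) ^+ 2) => -[|K].
    by rewrite /wsum big_nil addr_ge0 ?mulr_ge0 ?sqr_ge0.
  rewrite /wsum big_nat_recl// mul1r addrC lerD//.
  apply: (@le_trans _ _ (2 * \sum_(0 <= k < K.+1) k%:R * nc (a k) ^+ 2)).
    rewrite big_nat_recl// mul0r add0r mulr_sumr; apply: ler_sum => k _.
    by rewrite mulrA ler_wpM2r ?sqr_ge0// -natrM ler_nat; lia.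
  by rewrite ler_wpM2l.
split; first by exists a.
apply: (@le_lt_trans _ _ B%:E); last exact: ltry.
apply: le_trans (proj2 (dirichlet_norm_wle B af) aB).
by rewrite leeDl// nneseries_ge0// => k _ _; rewrite lee_fin sqrnorm_ge0.
Qed.

End Parseval.

(** * Divisibility by linear factors *)

Lemma prod_nat_recr (S : comNzRingType) (P : pred nat) (F : nat -> S) n :
  \prod_(0 <= i < n.+1 | P i) F i =
  \prod_(0 <= i < n | P i) F i * (if P n then F n else 1).
Proof. by rewrite big_mkcond big_nat_recr //= -big_mkcond. Qed.

Definition nocc (P : pred nat) n := (\sum_(0 <= i < n) P i)%N.

Lemma prod_nocc (S : comNzRingType) (P : pred nat) (F : nat -> S) (x : S) n :
  (forall i, P i -> F i = x) -> \prod_(0 <= i < n | P i) F i = x ^+ nocc P n.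
Proof.
move=> Fx; elim: n => [|n IH]; first by rewrite /nocc !big_nil expr0.
rewrite prod_nat_recr IH /nocc big_nat_recr//= exprD.
by case: ifPn => [/Fx ->|_].
Qed.

(** Connects multiplicities given by bijections, as in [vanishes_on], with exponents counted in
    finite products. *)
Lemma card_nocc (A : set nat) n :
  (A `&` `I_n #= `I_(nocc (fun i => `[< A i >]) n))%card.
Proof.
elim: n => [|n IH]; first by rewrite /nocc big_nil II0 setI0 card_eqxx.
have AS : A `&` `I_n.+1 = if `[< A n >] then n |` (A `&` `I_n) else A `&` `I_n.
  apply/seteqP; split => i /=.
    move=> [Ai]; rewrite ltnS leq_eqVlt => /orP[/eqP ein|ltin].
      by rewrite ein in Ai *; rewrite asboolT//; left.
    by case: ifPn => _; [right|].
  case: ifPn => [/asboolP An [->//|[Ai /= ltin]]|_ [Ai /= ltin]]; split => //=; exact: ltnW.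
rewrite AS /nocc big_nat_recr//= -/(nocc _ n).
case: ifPn => _; last by rewrite addn0.
rewrite addn1; apply/eq_cardSP; exists n; first by left.
suff -> : (n |` (A `&` `I_n)) `\ n = A `&` `I_n by [].
apply/seteqP; split => i /=; first by move=> [[->//|//]].
by move=> [Ai ltin]; split; [right|move=> ein; rewrite ein ltnn in ltin].
Qed.

Lemma nocc_le (A : set nat) n k : (A #= `I_k)%card ->
  (nocc (fun i => `[< A i >]) n <= k)%N.
Proof.
move=> Ak; rewrite -card_le_II.
rewrite -(card_le_eql (card_nocc A n)) -(card_le_eqr Ak).
by apply: subset_card_le; exact: subIsetl.
Qed.

Lemma nocc_eq (A : set nat) n k : (A #= `I_k)%card -> A `<=` `I_n ->
  nocc (fun i => `[< A i >]) n = k.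
Proof.
move=> Ak /setIidPl An; apply/card_eq_II.
by apply: card_eq_trans Ak; rewrite -{2}An card_eq_sym; exact: card_nocc.
Qed.

Section Divisibility.
Variable R : realType.
Local Notation C := (R[i] : numClosedFieldType).
Implicit Types (x y z w u : C) (a b c d : nat -> C) (f g : C -> C) (p q : {poly C}).

Lemma analyticD f g : analytic f -> analytic g -> analytic (fun z => f z + g z).
Proof.
move=> [a fa] [b gb]; exists (fun k => a k + b k) => z zd.
have := cvgD (fa z zd) (gb z zd).
have -> : (fun n => \sum_(0 <= k < n) a k * z ^+ k) + (fun n => \sum_(0 <= k < n) b k * z ^+ k) =
  (fun n => \sum_(0 <= k < n) (a k + b k) * z ^+ k).
  by apply/funext => n; under [RHS]eq_bigr do rewrite mulrDl; rewrite big_split.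
by move=> h; exact: h.
Qed.

Lemma analyticZ (c : C) f : analytic f -> analytic (fun z => c * f z).
Proof.
move=> [a fa]; exists (fun k => c * a k) => z zd.
have := @cvgMl_tmp _ _ _ _ _ c _ (fa z zd).
have -> : (fun n => c * \sum_(0 <= k < n) a k * z ^+ k) =
  (fun n => \sum_(0 <= k < n) (c * a k) * z ^+ k).
  by apply/funext => n /=; rewrite mulr_sumr; apply: eq_bigr => k _; rewrite mulrA.
by move=> h; exact: h.
Qed.

Lemma eq_analytic f g : (forall z, f z = g z) -> analytic f -> analytic g.
Proof. by move=> /funext ->. Qed.

(** z f = f - (1 - z) f, where the second product is an instance of [has_series_lmul]. *)
Lemma analyticX f : analytic f -> analytic (fun z => z * f z).
Proof.
move=> fa; have [a ha] := fa; have h := has_series_lmul (c := 1) ha.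
have ha' : analytic (fun z => (1 - 1 * z) * f z) by exists (lmul 1 a).
have := analyticD fa (analyticZ (-1) ha').
by apply: eq_analytic => z; ring.
Qed.

Lemma analytic_horner p f : analytic f -> analytic (fun z => p.[z] * f z).
Proof.
move=> fa; elim/poly_ind: p => [|p c IH].
  by apply: eq_analytic (analyticZ 0 fa) => z; rewrite horner0.
apply: eq_analytic (analyticD (analyticX IH) (analyticZ c fa)) => z.
by rewrite hornerMXaddC; ring.
Qed.

Definition pdiv p f := exists2 g, analytic g & forall w, disc w -> f w = p.[w] * g w.

Lemma pdiv_mull p q f : pdiv (p * q) f -> pdiv p f.
Proof.
move=> [g ga fE]; exists (fun z => q.[z] * g z); first exact: analytic_horner.
by move=> w wd; rewrite fE// hornerM mulrA.
Qed.

(** From u p + v q = 1, f = p g = q h gives f = p q (u h + v g). Bezout thus replaces a local study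
    of f at its zeros. *)
Lemma pdiv_coprime p q f : coprimep p q -> pdiv p f -> pdiv q f -> pdiv (p * q) f.
Proof.
move=> /Bezout_eq1_coprimepP[[u v] /= uv] [g ga gE] [h ha hE].
exists (fun z => u.[z] * h z + v.[z] * g z).
  by apply: analyticD; exact: analytic_horner.
move=> w wd; have /(congr1 (horner^~ w)) := uv; rewrite !hornerE /= => uvw.
rewrite -[LHS]mul1r -uvw mulrDl {1}hE// [in X in _ + X]gE//; ring.
Qed.

(* [lin 0 = 1], so indices outside the sequence contribute no factor. *)
Definition lin (c : C) : {poly C} := 1 - c%:P * 'X.

Lemma lin_horner (c w : C) : (lin c).[w] = 1 - c * w.
Proof. by rewrite /lin !hornerE. Qed.

Lemma lin_exp_horner (c w : C) m : (lin c ^+ m).[w] = (1 - c * w) ^+ m.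
Proof. by rewrite horner_exp lin_horner. Qed.

Lemma coprimep_lin (c d : C) : c != d -> coprimep (lin c) (lin d).
Proof.
move=> cd; have dc : d - c != 0 by rewrite subr_eq0 eq_sym.
apply/Bezout_eq1_coprimepP; exists ((d / (d - c))%:P, (- (c / (d - c)))%:P) => /=.
rewrite /lin !mulrBr !mulr1 !mulrA -!polyCM.
have -> : d / (d - c) * c = c * d / (d - c) by field.
have -> : - (c / (d - c)) * d = - (c * d / (d - c)) by field.
rewrite !polyCN mulNr opprK addrACA [X in _ + X]addrC addrN addr0 -polyCB.
by rewrite -mulrBl divff.
Qed.

Lemma coprimep_prod_lin (x : C) (c : nat -> C) n m :
  coprimep (lin x ^+ m) (\prod_(0 <= i < n | c i != x) lin (c i)).
Proof.
apply: coprimep_expl; elim: n => [|n IH]; first by rewrite big_nil coprimep1.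
rewrite prod_nat_recr coprimepMr IH /=.
by case: ifPn => [h|_]; [apply: coprimep_lin; rewrite eq_sym|rewrite coprimep1].
Qed.

(** The factors up to n split into those equal to the n-th, covered with their multiplicity by the
    hypothesis, and the others, which divide the previous product and are coprime to the first
    group. *)
Lemma pdiv_prod c f : analytic f ->
  (forall n, pdiv (\prod_(0 <= i < n.+1 | c i == c n) lin (c i)) f) ->
  forall n, pdiv (\prod_(0 <= i < n) lin (c i)) f.
Proof.
move=> fa H; elim=> [|n IH].
  by rewrite big_nil; exists f => // w _; rewrite hornerC mul1r.
rewrite (bigID (fun i => c i == c n)) /=; apply: pdiv_coprime; last 2 first.
- exact: H.
- rewrite prod_nat_recr eqxx mulr1; apply: (@pdiv_mull _ (\prod_(0 <= i < n | c i == c n) lin (c i))).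
  by move: IH; rewrite (bigID (fun i => c i == c n)) /= mulrC.
rewrite (@prod_nocc _ _ _ (lin (c n))); first exact: coprimep_prod_lin.
by move=> i /eqP ->.
Qed.

Fixpoint quotient c a n : nat -> C :=
  if n is n'.+1 then ldiv (c n') (quotient c a n') else a.

Lemma lprod_quotient c a n : lprod c n (quotient c a n) = a.
Proof. by elim: n => [//|n IH] /=; rewrite lmul_ldiv. Qed.

Lemma lprod_inj c n : injective (lprod c n).
Proof. by elim: n => [//|n IH] a b /= /IH; exact: lmul_inj. Qed.

Lemma quotient_series c a f n : has_series a f ->
  pdiv (\prod_(0 <= i < n) lin (c i)) f ->
  exists2 g, has_series (quotient c a n) g &
    forall w, disc w -> f w = \prod_(0 <= i < n) (1 - c i * w) * g w.
Proof.
move=> af [g [b bg] fE].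
have E w : (\prod_(0 <= i < n) lin (c i)).[w] = \prod_(0 <= i < n) (1 - c i * w).
  by rewrite horner_prod; apply: eq_bigr => i _; exact: lin_horner.
have fg w : disc w -> f w = \prod_(0 <= i < n) (1 - c i * w) * g w.
  by move=> wd; rewrite fE// E.
have bf : has_series (lprod c n b) f.
  move=> w wd; rewrite (fg w wd) big_mkord; exact: (@has_series_lprod _ c n _ _ bg w wd).
have ab : a = lprod c n b by exact: has_series_inj af bf.
have qb : quotient c a n = b by apply: (@lprod_inj c n); rewrite lprod_quotient.
by exists g; [rewrite qb; exact: bg|exact: fg].
Qed.

Lemma quotients_quotient c a f : has_series a f ->
  (forall n, pdiv (\prod_(0 <= i < n) lin (c i)) f) -> quotients c (quotient c a).
Proof.
move=> af H n; split; last by rewrite /= lmul_ldiv.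
by have [g hg _] := quotient_series af (H n); exact: has_series_subexp hg.
Qed.

End Divisibility.

(** * Zero sequences *)

Section ZeroSets.
Variable R : realType.
Local Notation C := (R[i] : numClosedFieldType).
Implicit Types (x y z w u : C) (f g : C -> C) (J : set nat) (S : nat -> C).

Definition invseq J S n : C := if `[< J n >] then (S n)^-1 else 0.

Definition nonzero_on J S := forall n, J n -> S n != 0.

Lemma invseq_mul J S z n : nonzero_on J S ->
  (invseq J S n * z == 1) = `[< occurrences J S z n >].
Proof.
move=> S0; rewrite /invseq /occurrences; apply/eqP/asboolP => /=.
  case: ifPn => [/asboolP Jn|_]; last by rewrite mul0r => /esym/eqP; rewrite oner_eq0.
  by move=> h; split=> //; apply: (mulfI (invr_neq0 (S0 n Jn))); rewrite h mulVf// S0.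
by move=> [Jn <-]; rewrite asboolT// mulVf// S0.
Qed.

Lemma invseq_eq J S i n : nonzero_on J S -> J n ->
  (invseq J S i == invseq J S n) = `[< occurrences J S (S n) i >].
Proof.
move=> S0 Jn; rewrite -invseq_mul//.
have -> : invseq J S n = (S n)^-1 by rewrite /invseq asboolT.
by apply/eqP/eqP => [->|h]; [rewrite mulVf ?S0|rewrite -[LHS]mulr1 -(mulfV (S0 n Jn)) mulrA h mul1r].
Qed.

Lemma vanishes_on_pdiv J S f : disc_sequence J S -> nonzero_on J S ->
  analytic f -> vanishes_on J S f ->
  forall n, pdiv (\prod_(0 <= i < n) lin (invseq J S i)) f.
Proof.
move=> [Sd fin] S0 fa fS; apply: pdiv_prod => // n.
rewrite (@prod_nocc _ _ _ (lin (invseq J S n))); last by move=> i /eqP ->.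
have [Jn|Jn] := pselect (J n); last first.
  rewrite /invseq asboolF// /lin mul0r subr0 expr1n.
  by exists f => // w _; rewrite hornerC mul1r.
set z := S n; have z0 : z != 0 by exact: S0.
have [k hk] : exists k, (occurrences J S z #= `I_k)%card by apply/finite_setP; exact: fin.
have [g ga fE] := fS z k (Sd n Jn) hk.
set m := nocc _ _.
have mk : (m <= k)%N.
  apply: leq_trans (nocc_le n.+1 hk); rewrite leq_eqVlt; apply/orP; left; apply/eqP.
  by apply: eq_bigr => i _; rewrite invseq_eq.
(* Since w - z = -z (1 - w / z), m of the k factors are traded for linear factors; the other k - m
   stay in the cofactor. *)
exists (fun w => ((- z) ^+ m *: ('X - z%:P) ^+ (k - m)).[w] * g w).
  exact: analytic_horner.
move=> w wd; rewrite fE//; apply: etrans (congr1 (fun t => t * _) (esym (lin_exp_horner _ _ _))).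
rewrite hornerZ horner_exp hornerXsubC !mulrA; congr (_ * _).
have -> : invseq J S n = z^-1 by rewrite /invseq asboolT.
rewrite -exprMn -[in LHS](subnKC mk) exprD; congr (_ ^+ _ * _).
by field.
Qed.

Lemma prod_occurrences J S z k N : nonzero_on J S ->
  (occurrences J S z #= `I_k)%card -> occurrences J S z `<=` `I_N ->
  exists2 kap : C, kap != 0 & forall w, \prod_(0 <= i < N) (1 - invseq J S i * w) =
   (w - z) ^+ k * (kap * \prod_(0 <= i < N | invseq J S i * z != 1) (1 - invseq J S i * w)).
Proof.
(* 1 - w / z = -z^-1 (w - z). At z = 0 there are no occurrences, so k = 0 and any nonzero default
   will do. *)
move=> S0 hk hN; pose x : C := if z == 0 then 1 else - z^-1.
have x0 : x != 0 by rewrite /x; case: ifPn; rewrite ?oner_eq0// oppr_eq0 invr_eq0.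
exists (x ^+ k); first by rewrite expf_neq0.
move=> w; rewrite (bigID (fun i => invseq J S i * z == 1)) /= mulrA; congr (_ * _).
rewrite (@prod_nocc _ _ _ (x * (w - z))); last first.
  move=> i /eqP h; have z0 : z != 0.
    by apply/eqP => z0; move: h; rewrite z0 mulr0 => /esym/eqP; rewrite oner_eq0.
  have -> : invseq J S i = z^-1 by rewrite -[LHS]mulr1 -(mulfV z0) mulrA h mul1r.
  by rewrite /x (negbTE z0); field.
rewrite exprMn mulrC; suff -> : nocc (fun i => invseq J S i * z == 1) N = k by [].
rewrite -(nocc_eq hk hN); apply: eq_bigr => i _; by rewrite invseq_mul.
Qed.

Lemma analytic_cancel1 z f g : analytic f -> analytic g ->
  (forall w, disc w -> (w - z) * f w = (w - z) * g w) ->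
  forall w, disc w -> f w = g w.
Proof.
move=> fa ga H.
have ea : analytic (fun w => f w + -1 * g w) by exact: (analyticD fa (analyticZ (-1) ga)).
have [a ha] := ea.
have zero : has_series (fun=> 0 : C) (fun=> 0 : C).
  move=> w wd; have -> : (fun n => \sum_(0 <= k < n) (0 : C) * w ^+ k) = (fun=> 0).
    by apply/funext => n; rewrite big1// => k _; rewrite mul0r.
  exact: cvg_cst.
have e0 w : disc w -> (w - z) * (f w + -1 * g w) = 0.
  by move=> wd; rewrite mulrDr H// mulN1r mulrN addrN.
have a0 : a = fun=> 0.
  (* For z = 0, w e = 0 is rewritten as e = (1 - w) e and read off coefficients; otherwise w - z is
     a multiple of 1 - w / z and [lmul] is injective. *)
  have [z0|z0] := eqVneq z 0.
    have E : a = lmul 1 a.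
      apply: (has_series_inj ha) => w wd; have := @has_series_lmul _ 1 _ _ ha w wd.
      by rewrite mulrBl !mul1r -[X in _ - X]subr0 -[0 in X in _ - X](e0 w wd) z0 subr0 subrr subr0.
    apply/funext => k; have /(congr1 (fun b => b k.+1)) := E.
    by rewrite /lmul mul1r => /eqP; rewrite -subr_eq0 opprB addrC subrK => /eqP.
  apply: (@lmul_inj _ z^-1); apply: (@has_series_inj _ _ _ (fun=> 0 : C)).
    move=> w wd; have := @has_series_lmul _ z^-1 _ _ ha w wd.
    suff -> : (1 - z^-1 * w) * (f w + -1 * g w) = 0 by [].
    by rewrite (_ : 1 - z^-1 * w = - z^-1 * (w - z)) -?mulrA ?e0 ?mulr0//; field.
  suff -> : lmul z^-1 (fun=> 0) = (fun=> 0) by [].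
  by apply/funext => -[|k]; rewrite /lmul mulr0 subr0.
move=> w wd; apply/eqP; rewrite -subr_eq0 -mulN1r; apply/eqP.
apply: ccvg_unique (ha w wd) _; rewrite a0; exact: zero.
Qed.

Lemma analytic_cancel z k f g : analytic f -> analytic g ->
  (forall w, disc w -> (w - z) ^+ k * f w = (w - z) ^+ k * g w) ->
  forall w, disc w -> f w = g w.
Proof.
move=> fa ga; elim: k => [|k IH] H.
  by move=> w wd; have := H w wd; rewrite !mul1r.
apply: IH; have X (h : C -> C) : analytic h -> analytic (fun w => (w - z) ^+ k * h w).
  move=> ha; apply: eq_analytic (analytic_horner (('X - z%:P) ^+ k) ha) => w.
  by rewrite horner_exp hornerXsubC.
apply: (@analytic_cancel1 z _ _ (X f fa) (X g ga)) => w wd.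
by rewrite !mulrA -!exprS H.
Qed.

Lemma summable_tail (v : nat -> R) (M e : R) : (forall n, 0 <= v n) ->
  (forall n, \sum_(0 <= k < n) v k <= M) -> 0 < e ->
  exists N, forall n, \sum_(0 <= k < n) v (N + k)%N <= e.
Proof.
move=> v0 hM e0; pose s n := \sum_(0 <= k < n) v k.
have nd : nondecreasing_seq s.
  apply/nondecreasing_seqP => n; rewrite /s big_nat_recr//= lerDl; exact: v0.
have cs : cvgn s by apply: nondecreasing_is_cvgn => //; exists M => _ [n _ <-]; exact: hM.
move/cvgrPdist_lt : (cs) => /(_ e e0)[N _ /(_ N (leqnn N)) /= hN].
exists N => n.
have -> : \sum_(0 <= k < n) v (N + k)%N = s (N + n)%N - s N.
  rewrite /s [in RHS](@big_cat_nat _ _ _ N) ?leq_addr//= addrAC subrr add0r.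
  rewrite -{2}[N]add0n big_addn addKn; apply: eq_bigr => k _; by rewrite addnC.
have := nondecreasing_cvgn_le nd cs (N + n)%N.
by have := ler_norm (limn s - s N); lra.
Qed.

Lemma wle_subexp (a : nat -> C) B : wle a B -> subexp a.
Proof.
move=> aB rho /andP[r0 r1]; exists (B + 1) => k.
have h := wle_nc1 k aB; rewrite -[leRHS]mulr1 ler_pM ?exprn_ge0//.
by rewrite exprn_ile1// ltW.
Qed.

Lemma polarE (rho th : R) : polar rho th = rho%:C%C * polar 1 th.
Proof. by apply/eqP; rewrite eq_complex /=; apply/andP; split; apply/eqP; ring. Qed.

Lemma nc_polar1 (th : R) : nc (polar 1 th) = 1.
Proof. by rewrite /nc /sqrnorm /= !mul1r cos2Dsin2 sqrtr1. Qed.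

Lemma nc_polar (rho th : R) : 0 <= rho -> nc (polar rho th) = rho.
Proof. by move=> r0; rewrite polarE ncM nc_polar1 mulr1 nc_real ger0_norm. Qed.

Section Moving.
Variables (J : set nat) (r s t : nat -> R).
Hypothesis hr : forall n, J n -> 0 < r n < 1.
Hypothesis hs : forall n, J n -> r n <= s n < 1.

Let Z n := polar (r n) (t n).
Let W n := polar (s n) (t n).
Let c := invseq J Z.
Let d := invseq J W.

Let Z0 : nonzero_on J Z.
Proof.
by move=> n /hr /andP[r0 _]; rewrite -nc_gt0 nc_polar// ltW.
Qed.

Let s0 n : J n -> 0 < s n.
Proof. by move=> Jn; have := hr Jn; have := hs Jn; lra. Qed.

Let W0 : nonzero_on J W.
Proof.
by move=> n /s0 sn; rewrite -nc_gt0 nc_polar// ltW.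
Qed.

Lemma invseq_same_ray n : same_ray (c n) (d n).
Proof.
rewrite /c /d /invseq; case: ifPn => [/asboolP Jn|_]; last first.
  by exists 1, 0, 0; rewrite nc1 rmorph0 mul0r; split => //; right.
have := hr Jn; have := hs Jn; have := s0 Jn => sn /andP[rs s1] /andP[r0 r1].
exists (polar 1 (t n))^-1, (r n)^-1, (s n)^-1; split.
- by rewrite ncV nc_polar1 invr1.
- by rewrite /Z polarE invfM fmorphV.
- by rewrite /W polarE invfM fmorphV.
- by left; rewrite invf_gt1// s1 lef_pV2// ?posrE.
Qed.

(** The Blaschke term 1/r_n - 1; c n = 0 marks the indices outside [J]. It dominates |c_n - d_n|. *)
Let v n : R := if c n == 0 then 0 else nc (c n) - 1.

Let ray_cases n : (c n = 0 /\ d n = 0) \/ [/\ 1 < nc (d n), nc (d n) <= nc (c n) &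
   nc (c n - d n) = nc (c n) - nc (d n)].
Proof.
have [u [y [e [u1 -> -> [/andP[e1 ye]|[-> ->]]]]]] := invseq_same_ray n; last first.
  by left; rewrite rmorph0 mul0r.
right; rewrite -mulrBl -rmorphB !ncM u1 !mulr1 !nc_real !ger0_norm; try lra.
by split.
Qed.

Let v_ge0 n : 0 <= v n.
Proof.
rewrite /v; case: ifPn => // c0; have [[h _]|[]] := ray_cases n; last lra.
by rewrite h eqxx in c0.
Qed.

Let nc_c n : nc (c n) <= 1 + v n.
Proof.
rewrite /v; case: ifPn => [/eqP ->|_]; last lra.
by rewrite nc0; lra.
Qed.

Let nc_d n : nc (d n) <= 1 + v n.
Proof.
have [[_ ->]|[_ h _]] := ray_cases n; last exact: le_trans h (nc_c n).
by rewrite nc0; have := v_ge0 n; lra.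
Qed.

Let nc_cd n : nc (c n - d n) <= v n.
Proof.
have [[-> ->]|[h1 h2 ->]] := ray_cases n; first by rewrite subrr nc0.
by have := nc_c n; lra.
Qed.

Section Summable.
Variable M : R.
Hypothesis hM : forall n, \sum_(0 <= k < n) v k <= M.

Lemma tail_bounds z : disc z -> exists N (sg : R), [/\ 0 < sg,
  forall n, sg <= nc (1 - c (N + n)%N * z),
  forall n, sg <= nc (1 - d (N + n)%N * z) &
  forall n, \sum_(0 <= k < n) nc (c (N + k)%N - d (N + k)%N) <= sg / 2].
Proof.
(* 1 - |z| = 2 sg, so |x| <= 1 + sg / 2 gives |1 - x z| >= 2 sg - sg / 2 >= sg. *)
move=> /discE z1; pose sg := (1 - nc z) / 2.
have sg0 : 0 < sg by rewrite /sg; lra.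
have sg2 : 0 < sg / 2 by rewrite divr_gt0.
have [N hN] := summable_tail v_ge0 hM sg2.
have vN n : v (N + n)%N <= sg / 2.
  apply: le_trans (hN n.+1); rewrite big_nat_recr//= lerDr.
  by apply: sumr_ge0 => k _; exact: v_ge0.
have key (x : C) n : nc x <= 1 + v (N + n)%N -> sg <= nc (1 - x * z).
  move=> hx; have := ler_nc_sub 1 (x * z); rewrite nc1 ncM.
  have h := vN n; have := ler_wpM2r (nc_ge0 z) hx; have := nc_ge0 z.
  have := ler_wpM2r (nc_ge0 z) h; move: h; rewrite /sg; nra.
exists N, sg; split => // [n|n|n]; [exact: (key _ n)|exact: (key _ n)|].
by apply: le_trans (hN n); apply: ler_sum => k _; exact: nc_cd.
Qed.

Lemma occurrences_sub S z N (sg : R) : nonzero_on J S -> 0 < sg ->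
  (forall n, sg <= nc (1 - invseq J S (N + n)%N * z)) -> occurrences J S z `<=` `I_N.
Proof.
move=> S0 sg0 h n hn /=; rewrite ltnNge; apply/negP => /subnKC Nn.
have := h (n - N)%N; rewrite Nn => hh.
have /eqP E : invseq J S n * z == 1 by rewrite invseq_mul//; exact/asboolP.
by move: hh; rewrite E subrr nc0; lra.
Qed.

(** Distinct zeros may be pushed onto one point, but only finitely many: in the tail 1 - d_n z is
    bounded away from 0. *)
Lemma moved_disc_sequence : disc_sequence J W.
Proof.
split=> [n Jn|z].
  have sn := s0 Jn; apply/discE; rewrite nc_polar ?(ltW sn)//.
  by have /andP[] := hs Jn.
have [zd|zd] := pselect (disc z).
  have [N [sg [sg0 _ hd _]]] := tail_bounds zd.
  by apply: sub_finite_set (finite_II N); exact: occurrences_sub hd.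
suff -> : occurrences J W z = set0 by exact: finite_set0.
apply/seteqP; split => // n [Jn Wz]; apply: zd; rewrite -Wz.
have sn := s0 Jn; apply/discE; rewrite nc_polar ?(ltW sn)//.
by have /andP[] := hs Jn.
Qed.

Lemma factor_zero S z k N (f g : C -> C) : nonzero_on J S -> analytic g ->
  (occurrences J S z #= `I_k)%card -> occurrences J S z `<=` `I_N ->
  (forall w, disc w -> f w = \prod_(0 <= i < N) (1 - invseq J S i * w) * g w) ->
  exists2 q : {poly C}, q.[z] != 0 &
    forall w, disc w -> f w = (w - z) ^+ k * (q.[w] * g w).
Proof.
move=> S0 ga hk hN fE; have [kap kap0 hkap] := prod_occurrences S0 hk hN.
pose q := kap%:P * \prod_(0 <= i < N | invseq J S i * z != 1) lin (invseq J S i).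
have qE w : q.[w] = kap * \prod_(0 <= i < N | invseq J S i * z != 1) (1 - invseq J S i * w).
  rewrite hornerM hornerC horner_prod; congr (_ * _).
  by apply: eq_bigr => i _; exact: lin_horner.
exists q => [|w wd]; last by rewrite fE// hkap qE !mulrA.
rewrite qE mulf_neq0// prodf_seq_neq0; apply/allP => i _; apply/implyP => h.
by rewrite subr_eq0 eq_sym.
Qed.

(** Stated for vanishing at least on the sequence, with exactness as a further implication, so that
    it serves both the zero sequence claim and the competitors for [gamma]. *)
Lemma move_zeros a f B : disc_sequence J Z -> has_series a f -> wle a B ->
  vanishes_on J Z f ->
  exists A F, [/\ has_series A F, wle A B, A 0%N = a 0%N, vanishes_on J W F &
    vanishes_exactly_on J Z f -> vanishes_exactly_on J W F].
Proof.
move=> dZ af aB fZ.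
have fa : analytic f by exists a.
have pd := vanishes_on_pdiv dZ Z0 fa fZ.
have hq := quotients_quotient af pd; set h := quotient _ a in hq.
have hcd := invseq_same_ray.
have sum_cd n : \sum_(0 <= k < n) nc (c k - d k) <= M.
  by apply: le_trans (hM n); apply: ler_sum => k _; exact: nc_cd.
have bnd : exists G : R, forall n, nc (c n) <= G.
  exists (1 + M) => n; apply: le_trans (nc_c n) _; rewrite lerD2l.
  apply: le_trans (hM n.+1); rewrite big_nat_recr//= lerDr.
  by apply: sumr_ge0 => k _; exact: v_ge0.
have [A hA] := moved_cvg hcd hq aB sum_cd bnd.
have AB : wle A B by apply: wle_cvg hA => n; exact: moved_wle.
have [F AF] := subexp_has_series (wle_subexp AB).
(* N lies beyond all occurrences of z, old and new; the tail limit G is then compared at z with f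
   divided by its first N factors. *)
have local z : disc z -> exists N (sg : R) (b : nat -> C) (G : C -> C),
    [/\ occurrences J Z z `<=` `I_N, occurrences J W z `<=` `I_N,
     has_series b G,
     forall w, disc w -> F w = \prod_(0 <= i < N) (1 - d i * w) * G w &
     forall g0, has_series (h N) g0 -> nc (g0 z) / 2 <= nc (G z)].
  move=> zd; have [N [sg [sg0 hc hd hsum]]] := tail_bounds zd.
  have hqN := quotients_shift N hq.
  have hcdN n : same_ray (c (N + n)%N) (d (N + n)%N) by exact: hcd.
  have [B' hB'] := quotients_wle hcd hq N aB.
  have hB0 : wle (h (N + 0)%N) B' by rewrite addn0.
  have bndN : exists G : R, forall n, nc (c (N + n)%N) <= G.
    by have [G hG] := bnd; exists G => n; exact: hG.
  have [b hb] := moved_cvg hcdN hqN hB0 hsum bndN.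
  have bB' : wle b B' by apply: wle_cvg hb => n; exact: (moved_wle hcdN hqN).
  have [G bG] := subexp_has_series (wle_subexp bB').
  have Ab := moved_cvg_shift hA hb.
  exists N, sg, b, G; split.
  - exact: (occurrences_sub Z0 sg0 hc).
  - exact: (occurrences_sub W0 sg0 hd).
  - exact: bG.
  - move=> w wd; apply: (ccvg_unique (AF w wd)); rewrite Ab big_mkord.
    exact: (@has_series_lprod _ d N _ _ bG w wd).
  - move=> g0 hg0; apply: (moved_nonvanishing hqN zd sg0 hc hsum _ hb _ bG).
      by move=> n k; apply: wle_nc1; exact: (moved_wle hcdN hqN).
    by rewrite addn0.
exists A, F; split => //.
- apply: (ccvg_unique (hA 0%N)); under eq_fun do rewrite (moved0 d hq).
  exact: cvg_cst.
- move=> z k zd hk; have [N [sg [b [G [_ hW bG FG _]]]]] := local z zd.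
  have Ga : analytic G by exists b.
  have [q _ hF] := factor_zero W0 Ga hk hW FG.
  by exists (fun w => q.[w] * G w); [exact: analytic_horner|exact: hF].
- move=> exact_ z k zd hk; have [N [sg [b [G [hZ hW bG FG hG]]]]] := local z zd.
  have Ga : analytic G by exists b.
  have [q q0 hF] := factor_zero W0 Ga hk hW FG.
  exists (fun w => q.[w] * G w); last exact: hF.
  split; first exact: analytic_horner.
  have [g0 hg0 fg0] := quotient_series af (pd N).
  have g0a : analytic g0 by exists (quotient c a N).
  have [j hj] : exists j, (occurrences J Z z #= `I_j)%card.
    by apply/finite_setP; exact: dZ.2.
  have [g1 [g1a g1z] fg1] := exact_ z j zd hj.
  have [q' _ fq'] := factor_zero Z0 g0a hj hZ fg0.
  (* Both sides are f divided by (w - z)^j; exactness of f therefore forces g0 z, and with it G z,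
     to be nonzero. *)
  have E : g1 z = q'.[z] * g0 z.
    apply: (analytic_cancel g1a (analytic_horner q' g0a) _ zd (k := j) (z := z)) => w wd.
    by rewrite -(fg1 w wd) (fq' w wd).
  have g0z : 0 < nc (g0 z).
    by rewrite nc_gt0; apply/eqP => g00; apply: g1z; rewrite E g00 mulr0.
  apply/eqP; rewrite mulf_neq0// -nc_gt0; apply: lt_le_trans (hG g0 hg0).
  by rewrite divr_gt0.
Qed.

End Summable.

Lemma zero_sequence_summable : zero_sequence J Z ->
  exists M : R, forall n, \sum_(0 <= k < n) v k <= M.
Proof.
move=> [dZ [f [fa fD] fZ]]; have [a af] := fa.
have fZ' : vanishes_on J Z f.
  by move=> z k zd hk; have [g [ga _] fg] := fZ z k zd hk; exists g.
have pd := vanishes_on_pdiv dZ Z0 fa fZ'.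
have hq := quotients_quotient af pd.
have [B aB] : exists B, wle a B by apply/(dirichlet_space_wle af).
apply: (blaschke (h := quotient c a) (B := B)) => //.
  move=> n; have [u [y [e [u1 cE _ [ye|[y0 _]]]]]] := invseq_same_ray n.
    by exists u, y; split => //; left; lra.
  by exists u, y; split => //; right.
have d0 : disc (0 : C) by apply/discE; rewrite nc0.
(* 0 is not in the sequence, so exact vanishing with multiplicity 0 there says that f 0 is
   nonzero. *)
have [|g [ga g0] fg] := fZ 0 0%N d0.
  suff -> : occurrences J Z 0 = set0 by rewrite II0 card_eqxx.
  by apply/seteqP; split => // n [Jn /eqP]; rewrite (negbTE (Z0 Jn)).
have := fg 0 d0; rewrite expr0 mul1r (has_series0 af) => E; rewrite /= E.
exact/eqP.
Qed.

End Moving.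

End ZeroSets.

Theorem theorem4p2 (R : realType) (J : set nat) (r s t : nat -> R)
  (hr : forall n, J n -> 0 < r n < 1)
  (hs : forall n, J n -> r n <= s n < 1)
  (hZ : zero_sequence J (fun n => polar (r n) (t n))) :
  zero_sequence J (fun n => polar (s n) (t n)) /\
  (gamma J (fun n => polar (r n) (t n)) <=
   gamma J (fun n => polar (s n) (t n)))%E.
Proof.
have [M hM] := zero_sequence_summable hr hs hZ.
have [dZ [f1 f1D f1Z]] := hZ.
split.
  split; first exact: moved_disc_sequence hM.
  have [[a af] _] := f1D.
  have [B aB] : exists B, wle a B by apply/(dirichlet_space_wle af).
  have f1Z' : vanishes_on J (fun n => polar (r n) (t n)) f1.
    by move=> z k zd hk; have [g [ga _] fg] := f1Z z k zd hk; exists g.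
  have [A [F [AF AB _ _ FW]]] := move_zeros hr hs hM dZ af aB f1Z'.
  exists F; last exact: FW.
  by apply/(dirichlet_space_wle AF); exists B.
(* Each competitor for the old sequence yields one for the new sequence with the same value at 0. *)
apply: ge_ereal_sup => _ [f [fD fZ fle1] <-].
have [[a af] _] := fD.
have norm_le (g : R[i] -> R[i]) (b : nat -> R[i]) : has_series b g -> (dirichlet_norm g <= 1)%E <-> wle b 1.
  move=> bg; rewrite /dirichlet_norm.
  have -> : 1%E = sqrte (1%:E : \bar R) by rewrite /= sqrtr1.
  by rewrite lee_sqrt ?lee_fin// (dirichlet_norm_wle 1 bg).
have [A [F [AF AB A0 FW _]]] := move_zeros hr hs hM dZ af ((norm_le _ _ af).1 fle1) fZ.
apply: ereal_sup_ubound; exists F.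
  split; [|exact: FW|exact/(norm_le _ _ AF)].
  by apply/(dirichlet_space_wle AF); exists 1.
by rewrite (has_series0 AF) A0 (has_series0 af).
Qed.
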